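(* Let $X$ be a real Banach lattice with $\dim X>1$, and let $S,T$ be linear operators on $X$ with $T\neq 0$, $0\leq S\leq T$ and $r(T)=r(S)$. (1) Suppose that $r(T)$ is a pole of $R(\cdot,T)$. Then $T=S$ if either $T$ is ideal irreducible, or $T$ is band irreducible and $\sigma$-order continuous and there is a $\sigma$-order continuous functional $x_0^*>0$ in $X^*$ such that $T^*x_0^*=r(T)x_0^*$. (2) Suppose that $r(S)$ is a pole of $R(\cdot,S)$. Then $T=S$ if either $S$ is ideal irreducible, or $S$ is band irreducible, there is a $\sigma$-order continuous functional $x_0^*>0$ in $X^*$ such that $S^*x_0^*=r(S)x_0^*$, and $T$ is $\sigma$-order continuous.
   Context: An operator $S$ on $X$ is positive ($S\geq 0$) if $Sx\geq 0$ whenever $x\geq 0$; $S\leq T$ means $T-S\geq 0$. Positive operators on Banach lattices are automatically bounded. $r(\cdot)$ denotes the spectral radius and $R(\lambda,T)=(\lambda-T)^{-1}$ the resolvent (spectral notions are taken on the complexification of $X$). $X^*$ is the dual Banach lattice and $T^*$ the adjoint of $T$. For a vector or functional, $x>0$ means $x\geq 0$ and $x\neq 0$. A positive operator is ideal irreducible if it has no non-zero proper invariant closed (order) ideals, and band irreducible if it has no non-zero proper invariant bands. A sequence $(x_n)$ in $X$ converges in order to $x$ if there is a sequence $y_n\downarrow 0$ in $X$ with $|x_n-x|\leq y_n$ for all $n$; an operator is $\sigma$-order continuous if it maps sequences converging in order to $0$ to sequences converging in order to $0$; a functional $x^*\in X^*$ is $\sigma$-order continuous if $x^*(x_n)\to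 0$ whenever $x_n\to 0$ in order. *)

(* Defs.v *)
From HB Require Import structures.
From mathcomp Require Import all_boot all_order all_algebra.
From mathcomp Require Import all_classical all_reals all_analysis.
From mathcomp Require Import complex ring lra.
Import Order.TTheory GRing.Theory Num.Theory.
Import numFieldNormedType.Exports.

Set Implicit Arguments.
Unset Strict Implicit.
Unset Printing Implicit Defensive.

Local Open Scope classical_set_scope.
Local Open Scope ring_scope.

(* The order is a field of the structure, and not inherited from latticeType,
   because HB rejects any new join of an order structure with a normed module
   (it would have to be declared below Num.NumDomain). The instances right
   after the declaration give back the library's order and lattice. *)
HB.mixin Record isBanachLattice (R : realType) (X : Type)
    & CompleteNormedModule R X := {
  vle : rel X ;
  vmeet : X -> X -> X ;
  vjoin : X -> X -> X ;
  vle_refl : reflexive vle ;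
  vle_anti : antisymmetric vle ;
  vle_trans : transitive vle ;
  vle_meet : forall x y z : X, vle x (vmeet y z) = vle x y && vle x z ;
  vle_join : forall x y z : X, vle (vjoin x y) z = vle x z && vle y z ;
  vle_add2r : forall z x y : X, vle x y -> vle (x + z) (y + z) ;
  vscale_ge0 : forall (a : R) (x : X), 0 <= a -> vle 0 x -> vle 0 (a *: x) ;
  vabs_le_norm : forall x y : X,
    vle (vjoin x (- x)) (vjoin y (- y)) -> `|x| <= `|y|
}.

#[short(type="banachLatticeType")]
HB.structure Definition BanachLattice (R : realType) :=
  { X of CompleteNormedModule R X & isBanachLattice R X }.

HB.instance Definition _ (R : realType) (X : banachLatticeType R) :=
  Order.Le_isPOrder.Build ring_display X
    (@vle_refl R X) (@vle_anti R X) (@vle_trans R X).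
HB.instance Definition _ (R : realType) (X : banachLatticeType R) :=
  Order.POrder_MeetJoin_isLattice.Build ring_display X
    (@vle_meet R X) (@vle_join R X).

Definition dim_gt1 (K : fieldType) (V : lmodType K) : Prop :=
  exists x y : V, forall a b : K, a *: x + b *: y = 0 -> a = 0 /\ b = 0.

Section order_notions.
Context {R : realType} {X : banachLatticeType R}.
Implicit Types (x y : X) (u : nat -> X) (I D : set X).

Definition labs x : X := Order.join x (- x).

Definition positive_op (T : X -> X) : Prop := forall x, 0 <= x -> 0 <= T x.

Definition op_le (S T : X -> X) : Prop := positive_op (T \- S).

Definition order_ideal I : Prop :=
  [/\ I 0,
      forall x y, I x -> I y -> I (x + y),
      forall (a : R) x, I x -> I (a *: x)
    & forall x y, labs x <= labs y -> I y -> I x].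

Definition band I : Prop :=
  order_ideal I /\ forall D s, D `<=` I -> supremums D s -> I s.

Definition ideal_irreducible (T : X -> X) : Prop :=
  positive_op T /\
  forall I, order_ideal I -> closed I -> T @` I `<=` I ->
    I = [set 0] \/ I = setT.

Definition band_irreducible (T : X -> X) : Prop :=
  positive_op T /\
  forall I, band I -> T @` I `<=` I -> I = [set 0] \/ I = setT.

Definition order_cvg u x : Prop :=
  exists y : nat -> X,
    [/\ nonincreasing_seq y, infimums (range y) 0
      & forall n, labs (u n - x) <= y n].

Definition sigma_order_continuous (T : X -> X) : Prop :=
  forall u, order_cvg u 0 -> order_cvg (T \o u) 0.

Definition functional_sigma_order_continuous (f : X -> R) : Prop :=
  forall u, order_cvg u 0 -> f \o u @ \oo --> (0 : R).

Definition functional_gt0 (f : X -> R) : Prop :=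
  (forall x, 0 <= x -> 0 <= f x) /\ exists x, f x != 0.

Definition adjoint (T : X -> X) (f : X -> R) : X -> R := f \o T.

End order_notions.

Section riesz_lemmas.
Context {R : realType} {X : banachLatticeType R}.
Implicit Types (x y z w : X) (a b : R).

Lemma rle_addr z x y : x <= y -> x + z <= y + z.
Proof. exact: vle_add2r. Qed.

Lemma rle_add x y z w : x <= y -> z <= w -> x + z <= y + w.
Proof.
move=> xy zw; apply: (le_trans (rle_addr z xy)).
by rewrite ![y + _]addrC; exact: rle_addr.
Qed.

Lemma rscale_ge0 a x : 0 <= a -> 0 <= x -> 0 <= a *: x.
Proof. exact: vscale_ge0. Qed.

Lemma rsubr_ge0 x y : (0 <= y - x) = (x <= y).
Proof.
apply/idP/idP => h.
  by have := rle_addr x h; rewrite add0r subrK.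
by have := rle_addr (- x) h; rewrite subrr.
Qed.

Lemma rscale_le a x y : 0 <= a -> x <= y -> a *: x <= a *: y.
Proof.
by move=> a0 xy; rewrite -rsubr_ge0 -scalerBr rscale_ge0// rsubr_ge0.
Qed.

Lemma labs_ge x : x <= labs x. Proof. exact: leUl. Qed.
Lemma labs_geN x : - x <= labs x. Proof. exact: leUr. Qed.

Lemma ge0_of_geN x w : x <= w -> - x <= w -> 0 <= w.
Proof.
move=> h1 h2; have := rle_add h1 h2; rewrite subrr => h.
have -> : w = 2^-1 *: (w + w).
  by rewrite -mulr2n -[w *+ 2]scaler_nat scalerA mulVf ?scale1r// pnatr_eq0.
by rewrite rscale_ge0// invr_ge0 ler0n.
Qed.

Lemma labs_ge0 x : 0 <= labs x.
Proof. exact: ge0_of_geN (labs_ge x) (labs_geN x). Qed.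

Lemma le_rnorm x w : x <= w -> - x <= w -> `|x| <= `|w|.
Proof.
move=> h1 h2; apply: vabs_le_norm.
change (labs x <= labs w); apply: le_trans (labs_ge w).
by rewrite /labs leUx h1 h2.
Qed.

Lemma scale_le_labs a x : `|a| <= 1 -> a *: x <= labs x.
Proof.
rewrite ler_norml => /andP[a1 a2].
have h b y : 0 <= b -> b <= 1 -> y <= labs x -> b *: y <= labs x.
  move=> b0 b1 yx; apply: (le_trans (rscale_le b0 yx)).
  rewrite -rsubr_ge0 -{1}[labs x]scale1r -scalerBl rscale_ge0 ?subr_ge0//.
  exact: labs_ge0.
have [a0|a0] := leP 0 a; first exact: h (labs_ge x).
rewrite -[a]opprK scaleNr -scalerN; apply: h (labs_geN x); last by lra.
by rewrite oppr_ge0 ltW.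
Qed.

End riesz_lemmas.

(* The complexification of X; the pair (x, y) stands for x + iy. *)
Definition cplx (X : Type) : Type := (X * X)%type.

Section complexification.
Context {R : realType} {X : banachLatticeType R}.
Implicit Types (z : cplx X) (c : R[i]).

HB.instance Definition _ := GRing.Zmodule.copy (cplx X) (X * X)%type.

Definition cplx_scale c z : cplx X :=
  let: Complex a b := c in (a *: z.1 - b *: z.2, b *: z.1 + a *: z.2).

Fact cplx_scaleA c d z :
  cplx_scale c (cplx_scale d z) = cplx_scale (c * d) z.
Proof.
case: c d z => [a b] [a' b'] [x y]; congr pair => /=.
  by rewrite scalerBr scalerDr opprD !scalerA addrACA scalerBl scalerDl opprD.
rewrite scalerBr scalerDr !scalerA addrACA scalerBl scalerDl.
by congr (_ + _); rewrite addrC.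
Qed.

Fact cplx_scale1 : left_id 1 cplx_scale.
Proof.
by move=> [x y]; rewrite /cplx_scale /= !scale1r !scale0r subr0 add0r.
Qed.

Fact cplx_scaleDr : right_distributive cplx_scale +%R.
Proof.
move=> [a b] [x y] [x' y']; congr pair => /=.
  by rewrite !scalerDr opprD addrACA.
by rewrite !scalerDr addrACA.
Qed.

Fact cplx_scaleDl z : {morph cplx_scale^~ z : c d / c + d}.
Proof.
case: z => [x y] [a b] [a' b']; congr pair => /=.
  by rewrite !scalerDl opprD addrACA.
by rewrite !scalerDl addrACA.
Qed.

HB.instance Definition _ := GRing.Zmodule_isLmodule.Build R[i] (cplx X)
  cplx_scaleA cplx_scale1 cplx_scaleDr cplx_scaleDl.

(* The upper bounds in X of {cos(t) x + sin(t) y | t in R}, whose least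
   element is the modulus |x + iy|. *)
Definition cplx_ubound z : set X :=
  [set w | forall a b : R, a ^+ 2 + b ^+ 2 = 1 -> a *: z.1 + b *: z.2 <= w].

(* This is ‖ |z| ‖: the modulus is in the set, and a larger element of X+ has a
   larger norm. The infimum spares a proof that the modulus exists. *)
Definition cplx_norm z : R := inf [set `|w| | w in cplx_ubound z].

Lemma cplx_ubound_re z w : cplx_ubound z w -> z.1 <= w /\ - z.1 <= w.
Proof.
move=> h; split.
  by have := h 1 0; rewrite scale1r scale0r addr0 expr1n expr0n addr0; exact.
have := h (-1) 0; rewrite scaleN1r scale0r addr0 sqrrN expr1n expr0n addr0.
exact.
Qed.

Lemma cplx_ubound_im z w : cplx_ubound z w -> z.2 <= w /\ - z.2 <= w.
Proof.
move=> h; split.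
  by have := h 0 1; rewrite scale1r scale0r add0r expr1n expr0n add0r; exact.
have := h 0 (-1); rewrite scaleN1r scale0r add0r sqrrN expr1n expr0n add0r.
exact.
Qed.

Lemma cplx_ubound_nonempty z : cplx_ubound z (labs z.1 + labs z.2).
Proof.
move=> a b ab; apply: rle_add; apply: scale_le_labs.
  rewrite -(@ler_pXn2r _ 2)// ?nnegrE// expr1n real_normK ?num_real//.
  by rewrite -ab lerDl sqr_ge0.
rewrite -(@ler_pXn2r _ 2)// ?nnegrE// expr1n real_normK ?num_real//.
by rewrite -ab lerDr sqr_ge0.
Qed.

Lemma cplx_norm_lb z w : cplx_ubound z w -> cplx_norm z <= `|w|.
Proof.
move=> zw; apply: ge_inf; last by exists w.
by exists 0 => _ [v _ <-]; exact: normr_ge0.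
Qed.

Lemma cplx_norm_glb z (e : R) :
  (forall w, cplx_ubound z w -> e <= `|w|) -> e <= cplx_norm z.
Proof.
move=> h; apply: lb_le_inf => [|_ [w zw <-]]; last exact: h.
exists `|labs z.1 + labs z.2|; exists (labs z.1 + labs z.2) => //.
exact: cplx_ubound_nonempty.
Qed.

Lemma cplx_norm_ge0 z : 0 <= cplx_norm z.
Proof. by apply: cplx_norm_glb => w _; exact: normr_ge0. Qed.

Lemma le_cplx_norm z : `|z.1| <= cplx_norm z /\ `|z.2| <= cplx_norm z.
Proof.
split; apply: cplx_norm_glb => w zw.
  by have [] := cplx_ubound_re zw; exact: le_rnorm.
by have [] := cplx_ubound_im zw; exact: le_rnorm.
Qed.

Lemma cplx_norm_triangle z t : cplx_norm (z + t) <= cplx_norm z + cplx_norm t.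
Proof.
rewrite -lerBlDr; apply: cplx_norm_glb => w zw; rewrite lerBlDl -lerBlDr.
apply: cplx_norm_glb => v tv; rewrite lerBlDr.
apply: le_trans (_ : `|v + w| <= _); last exact: ler_normD.
apply: cplx_norm_lb => a b ab /=; rewrite !scalerDr addrACA [v + w]addrC.
by apply: rle_add; [exact: zw|exact: tv].
Qed.

Lemma cplx_norm0_eq0 z : cplx_norm z = 0 -> z = 0.
Proof.
move=> z0; have [] := le_cplx_norm z; rewrite z0 !normr_le0.
by case: z {z0} => x y /= /eqP -> /eqP ->.
Qed.

Lemma cplx_normZ_le c z :
  cplx_norm (c *: z) <= ComplexField.Normc.normc c * cplx_norm z.
Proof.
have [->|c0] := eqVneq c 0.
  rewrite scale0r ComplexField.Normc.normc0 mul0r -[leRHS](@normr0 _ X).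
  by apply: cplx_norm_lb => a b _ /=; rewrite !scaler0 addr0.
have r0 : 0 < ComplexField.Normc.normc c.
  rewrite lt_def; apply/andP; split; last by case: c {c0} => a b; exact: sqrtr_ge0.
  by apply: contra_neq c0; exact: ComplexField.Normc.eq0_normc.
have rE : ComplexField.Normc.normc c ^+ 2 = complex.Re c ^+ 2 + complex.Im c ^+ 2.
  by case: c {c0 r0} => a b /=; rewrite sqr_sqrtr// addr_ge0 ?sqr_ge0.
set r := ComplexField.Normc.normc c in r0 rE *.
rewrite -ler_pdivrMl//; apply: cplx_norm_glb => w zw.
rewrite ler_pdivrMl// -{1}[r]gtr0_norm// -normrZ.
apply: cplx_norm_lb => a b ab.
have -> : c *: z = (complex.Re c *: z.1 - complex.Im c *: z.2,
    complex.Im c *: z.1 + complex.Re c *: z.2) :> cplx X by case: (c).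
move: (complex.Re c) (complex.Im c) rE => u v rE /=.
move: r r0 rE => {c0} r r0 rE.
have -> : a *: (u *: z.1 - v *: z.2) + b *: (v *: z.1 + u *: z.2) =
    r *: (((a * u + b * v) / r) *: z.1 + ((b * u - a * v) / r) *: z.2).
  rewrite [in RHS]scalerDr ![in RHS]scalerA !(mulrC r) !divfK ?gt_eqF//.
  rewrite scalerBr scalerDr !scalerA addrACA -scalerDl -scaleNr -scalerDl.
  by congr (_ + _ *: _); rewrite addrC.
apply: rscale_le; first exact: ltW.
apply: zw; rewrite !expr_div_n -mulrDl rE.
have rn0 : u ^+ 2 + v ^+ 2 != 0 by rewrite -rE expf_neq0// gt_eqF.
apply: (mulIf rn0); rewrite divfK//.
rewrite -[X in _ = X * _]ab; ring.
Qed.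

Lemma cplx_normZ c z :
  cplx_norm (c *: z) = ComplexField.Normc.normc c * cplx_norm z.
Proof.
apply/eqP; rewrite eq_le cplx_normZ_le /=.
have [->|c0] := eqVneq c 0.
  by rewrite ComplexField.Normc.normc0 mul0r cplx_norm_ge0.
have n0 : ComplexField.Normc.normc c != 0.
  by apply: contra_neq c0; exact: ComplexField.Normc.eq0_normc.
have /ler_wpM2l := cplx_normZ_le c^-1 (c *: z).
move=> /(_ (ComplexField.Normc.normc c)) h.
have {h} := h _; rewrite scalerA mulVf// scale1r ComplexField.Normc.normcV.
rewrite mulrA divff// mul1r; apply.
by case: c {c0 n0} => a b; exact: sqrtr_ge0.
Qed.

Local Open Scope complex_scope.

Fact cplx_normC_triangle z t :
  (cplx_norm (z + t))%:C <= (cplx_norm z)%:C + (cplx_norm t)%:C.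
Proof. by rewrite -rmorphD lecR cplx_norm_triangle. Qed.

Fact cplx_normCZ c z : (cplx_norm (c *: z))%:C = `|c| * (cplx_norm z)%:C.
Proof. by rewrite cplx_normZ rmorphM. Qed.

Fact cplx_normC_eq0 z : (cplx_norm z)%:C = 0 -> z = 0.
Proof. by move=> /complexI; exact: cplx_norm0_eq0. Qed.

HB.instance Definition _ := Lmodule_isNormed.Build R[i] (cplx X)
  cplx_normC_triangle cplx_normCZ cplx_normC_eq0.

(* x + iy |-> T x + i T y *)
Definition cplx_op (T : X -> X) z : cplx X := (T z.1, T z.2).

Fact cplx_op_linear (T : {linear X -> X}) : linear (cplx_op T).
Proof.
by move=> [a b] [x y] [x' y']; congr pair; rewrite /= !linearD ?linearN !linearZ.
Qed.

HB.instance Definition _ (T : {linear X -> X}) :=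
  GRing.isLinear.Build R[i] (cplx X) (cplx X) _ (cplx_op T)
    (cplx_op_linear T).

End complexification.

Section spectral_notions.
Context {K : numFieldType} {V : normedModType K}.
Implicit Types (A : {linear V -> V}) (z : K).

Definition op_norm_cvg (F : nat -> V -> V) (L : V -> V) : Prop :=
  forall e : K, 0 < e ->
    \forall n \near \oo, forall v, `|F n v - L v| <= e * `|v|.

Definition resolvent_set A : set K :=
  [set z | exists B : {linear V -> V},
     [/\ continuous B, cancel (fun v => z *: v - A v) B
       & cancel B (fun v => z *: v - A v)]].

Definition spectrum A : set K := ~` resolvent_set A.

(* R(z, A) = (z - A)^-1; the value is 0 at points without a preimage. *)
Definition resolvent A z : V -> V :=
  fun w => xget 0 [set v | z *: v - A v = w].

(* z0 is a pole of order n.+1: near z0, the Laurent series of R(., A) at z0 is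
   R(z, A) = \sum_(k >= 0) (z - z0)^(k - n.+1) C_k with C_0 <> 0. *)
Definition resolvent_pole_of_order A z0 (n : nat) : Prop :=
  exists C : nat -> {linear V -> V},
    [/\ forall k, continuous (C k),
        exists v, C 0%N v != 0
      & \forall z \near z0^',
          resolvent_set A z /\
          op_norm_cvg
            (fun N v => \sum_(k < N) (z - z0) ^ (k%:Z - n.+1%:Z) *: C k v)
            (resolvent A z)].

Definition resolvent_pole A z0 : Prop :=
  exists n, resolvent_pole_of_order A z0 n.

End spectral_notions.

Section real_operators.
Context {R : realType} {X : banachLatticeType R}.
Implicit Type T : {linear X -> X}.
Local Open Scope complex_scope.

(* r(T) for a real operator T, read on the complexification *)
Definition spectral_radius T : R :=
  sup [set ComplexField.Normc.normc z | z in spectrum (cplx_op T)].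

(* r is a pole of R(., T), read on the complexification *)
Definition is_pole_of_resolvent T (r : R) : Prop :=
  resolvent_pole (cplx_op T) r%:C.

End real_operators.

(* Main.v *)
(** Write D = T - S. The leading Laurent coefficient Q of the irreducible
    operator at its pole r is positive and commutes with it. Irreducibility makes
    every positive eigenvector for r a weak unit and Q strictly positive, so the
    pole is simple and Q x = f(x) e with f strictly positive and f fixed up to the
    factor r by the adjoint. It then suffices that f (D e) = 0, since D e = 0 and
    irreducibility force D = 0.
    If r is a pole of T, approximate eigenvectors u >= 0 of S at r (which exist
    because r = r(S)) satisfy u <= f(u) e up to a small error; as f(D u) is small,
    f(D e) = 0.
    If r is a pole of S and f(D e) > 0, then D R(z, S) expands a cone around D e
    for z close to r, which contradicts that the Neumann series
    R(z, T) = \sum_k R(z, S) (D R(z, S))^k stays bounded for z > r = r(T). *)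

From HB Require Import structures.
Require Import Defs.
From mathcomp Require Import all_boot all_order all_algebra.
From mathcomp Require Import all_classical all_reals all_analysis.
From mathcomp Require Import complex ring lra.
Import Order.TTheory GRing.Theory Num.Theory.
Import numFieldNormedType.Exports.

Set Implicit Arguments.
Unset Strict Implicit.
Unset Printing Implicit Defensive.

Local Open Scope classical_set_scope.
Local Open Scope ring_scope.

(** * Riesz spaces *)

Section riesz.
Context {R : realType} {X : banachLatticeType R}.
Implicit Types (x y z w e : X) (a b c : R).

Local Notation meet := (@Order.meet ring_display X).
Local Notation join := (@Order.join ring_display X).

(** The spectral radius is a supremum over a complex spectrum, while the argument lives on order
    estimates in [X]. The two meet in three places: a resolvent at a real point restricts to a real
    operator ([resolvent_set_real]), the leading Laurent coefficient is a real operator approached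
    along [r + t] with [t > 0] ([pole_coefficient]), and growth bounds on the iterates of a real
    operator bound the spectral radius from above ([resolvent_set_power_bound]). The obstacle in the
    comparison of [S] and [T] is that [e] need not be an order unit: a vector small in norm need not
    lie below a small multiple of [e]. Errors are therefore kept in norm and pass to scalars only
    through [|f x| <= F |x|]; conversely, lower bounds on [f] come from a norm ([|u| = 1]) or from a
    cone on which [f] dominates a multiple of the norm. *)

Definition ppart x : X := join x 0.

Lemma rleD2r z x y : (x + z <= y + z) = (x <= y).
Proof.
by apply/idP/idP => [/(rle_addr (- z))|/rle_addr]//; rewrite !addrK.
Qed.

Lemma rleBlDr x y z : (x - y <= z) = (x <= z + y).
Proof. by rewrite -[LHS](rleD2r y) subrK. Qed.

Lemma rleBrDr x y z : (x <= y - z) = (x + z <= y).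
Proof. by rewrite -[LHS](rleD2r z) subrK. Qed.

Lemma rleN2 x y : (- x <= - y) = (y <= x).
Proof. by rewrite -[LHS]rsubr_ge0 opprK addrC rsubr_ge0. Qed.

Lemma raddr_ge0 x y : 0 <= x -> 0 <= y -> 0 <= x + y.
Proof. by move=> x0 y0; rewrite -(addr0 0); exact: rle_add. Qed.

Lemma rlerDl x y : (x <= x + y) = (0 <= y).
Proof. by rewrite -{1}(add0r x) [x + y]addrC rleD2r. Qed.

Lemma rlerDr x y : (x <= y + x) = (0 <= y).
Proof. by rewrite addrC rlerDl. Qed.

Lemma rlerBl x y : (x - y <= x) = (0 <= y).
Proof. by rewrite rleBlDr rlerDl. Qed.

Lemma rscale_ler a b x : a <= b -> 0 <= x -> a *: x <= b *: x.
Proof.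
by move=> ab x0; rewrite -rsubr_ge0 -scalerBl rscale_ge0// subr_ge0.
Qed.

Lemma rscaleP a x : 0 < a -> (0 <= a *: x) = (0 <= x).
Proof.
move=> a0; apply/idP/idP => h; last by rewrite rscale_ge0// ltW.
have := rscale_ge0 (ltW (_ : 0 < a^-1)) h.
by rewrite scalerA mulVf ?gt_eqF// scale1r; apply; rewrite invr_gt0.
Qed.

Lemma rle_pZl a x y : 0 < a -> (a *: x <= a *: y) = (x <= y).
Proof. by move=> a0; rewrite -rsubr_ge0 -scalerBr rscaleP// rsubr_ge0. Qed.

Lemma joinD z x y : join x y + z = join (x + z) (y + z).
Proof.
apply/eqP; rewrite eq_le; apply/andP; split; last first.
  by rewrite leUx !rleD2r leUl leUr.
by rewrite -rleBrDr leUx !rleBrDr leUl leUr.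
Qed.

Lemma meetD z x y : meet x y + z = meet (x + z) (y + z).
Proof.
apply/eqP; rewrite eq_le; apply/andP; split.
  by rewrite lexI !rleD2r leIl leIr.
by rewrite -rleBlDr lexI !rleBlDr leIl leIr.
Qed.

Lemma joinN x y : - join x y = meet (- x) (- y).
Proof.
apply/eqP; rewrite eq_le; apply/andP; split.
  by rewrite lexI !rleN2 leUl leUr.
by rewrite -(opprK (meet _ _)) rleN2 leUx -!(rleN2 (- meet _ _)) !opprK leIl leIr.
Qed.

Lemma join_meet x y : join x y + meet x y = x + y.
Proof.
have -> : meet x y = (x + y) - join x y.
  by rewrite addrC joinN meetD addrA addNr add0r addrCA addNr addr0 meetC.
by rewrite addrC subrK.
Qed.

Lemma subr_meet x y : x - meet x y = ppart (x - y).
Proof.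
rewrite /ppart -(subrr y) -joinD; apply/eqP.
by rewrite subr_eq addrAC eq_sym subr_eq join_meet.
Qed.

Lemma joinZ a x y : 0 <= a -> a *: join x y = join (a *: x) (a *: y).
Proof.
rewrite le_eqVlt => /predU1P[<-|a0]; first by rewrite !scale0r joinxx.
apply/eqP; rewrite eq_le; apply/andP; split; last first.
  by rewrite leUx !rle_pZl// leUl leUr.
rewrite -[leRHS]scale1r -(divff (lt0r_neq0 a0)) -scalerA rle_pZl//.
rewrite leUx -[X in X && _](rle_pZl _ _ a0) -[X in _ && X](rle_pZl _ _ a0).
rewrite !scalerA mulfV ?lt0r_neq0// !scale1r.
by rewrite leUl leUr.
Qed.

Lemma meetZ a x y : 0 <= a -> a *: meet x y = meet (a *: x) (a *: y).
Proof.
move=> a0; have := joinN (- x) (- y); rewrite !opprK => <-.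
by rewrite scalerN joinZ// joinN !scalerN !opprK.
Qed.

Lemma ppart_ge0 x : 0 <= ppart x. Proof. exact: leUr. Qed.
Lemma ppart_ge x : x <= ppart x. Proof. exact: leUl. Qed.

Lemma ppart_le x y : x <= y -> ppart x <= ppart y.
Proof. by move=> xy; rewrite leUx ppart_ge0 andbT (le_trans xy (ppart_ge y)). Qed.

Lemma ppart_lub x y : x <= y -> 0 <= y -> ppart x <= y.
Proof. by move=> xy y0; rewrite leUx xy. Qed.

Lemma ge0_ppart x : 0 <= x -> ppart x = x.
Proof. exact: join_l. Qed.

Lemma ppartD x y : ppart (x + y) <= ppart x + ppart y.
Proof.
by rewrite ppart_lub ?raddr_ge0 ?ppart_ge0// rle_add// ppart_ge.
Qed.

Lemma ppartZ a x : 0 <= a -> ppart (a *: x) = a *: ppart x.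
Proof. by move=> a0; rewrite joinZ// scaler0. Qed.

Lemma ppartB x : ppart x - ppart (- x) = x.
Proof.
by rewrite /ppart joinN opprK oppr0 join_meet addr0.
Qed.

Lemma labsE x : labs x = ppart x + ppart (- x).
Proof.
have -> : ppart (- x) = ppart x - x by rewrite -{3}(ppartB x) subKr.
rewrite addrA -mulr2n -scaler_nat -ppartZ// /ppart joinD add0r.
by rewrite scaler_nat mulr2n addrK.
Qed.

Lemma meet_ppart x : meet (ppart x) (ppart (- x)) = 0.
Proof.
have := subr_meet (ppart x) (ppart (- x)); rewrite ppartB.
by move/eqP; rewrite subr_eq addrC -subr_eq subrr => /eqP.
Qed.

Lemma labs_ge0_id x : 0 <= x -> labs x = x.
Proof.
move=> x0; apply/eqP; rewrite eq_le labs_ge andbT leUx lexx/=.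
by apply: (le_trans _ x0); rewrite -oppr0 rleN2.
Qed.

Lemma labsN x : labs (- x) = labs x.
Proof. by rewrite /labs opprK joinC. Qed.

Lemma labs_le x y : x <= y -> - x <= y -> labs x <= y.
Proof. by move=> xy Nxy; rewrite leUx xy. Qed.

Lemma labsD x y : labs (x + y) <= labs x + labs y.
Proof.
apply: labs_le; first exact: rle_add (labs_ge _) (labs_ge _).
by rewrite opprD; exact: rle_add (labs_geN _) (labs_geN _).
Qed.

Lemma labsZ a x : labs (a *: x) = `|a| *: labs x.
Proof.
have [a0|a0] := ger0P a; first by rewrite /labs joinZ// scalerN.
by rewrite -labsN -scaleNr /labs joinZ ?scalerN// oppr_ge0 ltW.
Qed.

Lemma labs0_eq0 x : labs x = 0 -> x = 0.
Proof.
move=> x0; apply/eqP; rewrite eq_le -{1}x0 labs_ge/=.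
by rewrite -rleN2 oppr0 -x0 labs_geN.
Qed.

Lemma norm_labs x : `|labs x| = `|x|.
Proof.
apply/eqP; rewrite eq_le; apply/andP; split; last exact: le_rnorm (labs_ge x) (labs_geN x).
by apply: vabs_le_norm; change (labs (labs x) <= labs x); rewrite labs_ge0_id ?labs_ge0.
Qed.

Lemma norm_le x y : 0 <= x -> x <= y -> `|x| <= `|y|.
Proof.
move=> x0 xy; apply: le_rnorm => //.
by apply: (le_trans _ (le_trans x0 xy)); rewrite -oppr0 rleN2.
Qed.

Lemma labs_le_norm x y : labs x <= y -> `|x| <= `|y|.
Proof. by move=> xy; rewrite -norm_labs norm_le// labs_ge0. Qed.

Lemma ppart_labs x : ppart x <= labs x.
Proof. by rewrite ppart_lub ?labs_ge0 ?labs_ge. Qed.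

Lemma norm_ppart x : `|ppart x| <= `|x|.
Proof. by rewrite -[leRHS]norm_labs norm_le ?ppart_ge0 ?ppart_labs. Qed.

Lemma ppart_norm_le x y d : x <= y + d -> `|ppart x| <= `|ppart y| + `|d|.
Proof.
move=> xyd; apply: le_trans (norm_le (ppart_ge0 _) (ppart_le xyd)) _.
apply: le_trans (norm_le (ppart_ge0 _) (ppartD _ _)) _.
by apply: le_trans (ler_normD _ _) _; rewrite lerD2l norm_ppart.
Qed.

(** This is the closedness of the positive cone: the positive part of [x - y] is bounded in norm by
    every [|d|]. *)
Lemma le_approx x y :
  (forall r : R, 0 < r -> exists2 d, x <= y + d & `|d| <= r) -> x <= y.
Proof.
move=> h; suff /eqP : ppart (x - y) = 0.
  by move=> /eqP xy; rewrite -rsubr_ge0 -opprB -oppr0 rleN2 -xy ppart_ge.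
apply/eqP; rewrite -normr_le0; apply/ler_addgt0Pl => e e0; rewrite addr0.
have [d xd de] := h _ e0; apply: (le_trans _ de).
have := @ppart_norm_le (x - y) 0 d.
rewrite [ppart 0]joinxx normr0 !add0r; apply.
by rewrite rleBlDr addrC.
Qed.

(** The right side is the infimum of the four sums [z + z], [x + z], [z + y] and [x + y], each of
    which lies above the left side. *)
Lemma meetDr_le x y z : 0 <= x -> 0 <= y -> 0 <= z ->
  meet z (x + y) <= meet z x + meet z y.
Proof.
move=> x0 y0 z0; rewrite [X in _ <= X]addrC meetD lexI; apply/andP; split.
  rewrite (addrC z) meetD lexI; apply/andP; split.
    by apply: le_trans (leIl _ _) _; rewrite rlerDl.
  by apply: le_trans (leIl _ _) _; rewrite rlerDr.
rewrite (addrC y) meetD lexI; apply/andP; split.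
  by apply: le_trans (leIl _ _) _; rewrite rlerDl.
by rewrite leIr.
Qed.

Lemma meet_ge0 x y : 0 <= x -> 0 <= y -> 0 <= meet x y.
Proof. by move=> x0 y0; rewrite lexI x0. Qed.

Lemma meetZ_eq0 a x z : 0 <= a -> 0 <= x -> 0 <= z -> meet z x = 0 ->
  meet z (a *: x) = 0.
Proof.
move=> a0 x0 z0 zx; apply/eqP; rewrite eq_le meet_ge0 ?rscale_ge0// andbT.
apply: le_trans (_ : meet ((a + 1) *: z) ((a + 1) *: x) <= _).
  rewrite lexI; apply/andP; split.
    by apply: le_trans (leIl _ _) _; rewrite -{1}(scale1r z) rscale_ler// lerDr.
  by apply: le_trans (leIr _ _) _; rewrite rscale_ler// lerDl.
by rewrite -meetZ ?addr_ge0// zx scaler0.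
Qed.

Lemma archimedean x v : 0 <= v -> (forall n, v *+ n <= x) -> v = 0.
Proof.
move=> v0 h; apply/eqP; rewrite -normr_le0 leNgt; apply/negP => v'0.
pose n := Num.bound (`|x| / `|v|).
have := norm_le (_ : 0 <= v *+ n) (h n); rewrite -scaler_nat rscale_ge0//.
move=> /(_ isT); rewrite normrZ normr_nat leNgt => /negP; apply.
by rewrite -ltr_pdivrMr// archi_boundP// divr_ge0.
Qed.

End riesz.

Section positive_operators.
Context {R : realType} {X : banachLatticeType R}.
Implicit Types (x y z w e : X) (a b c : R) (T S : {linear X -> X}).

Lemma positive_le T x y : positive_op T -> x <= y -> T x <= T y.
Proof.
by move=> T0 xy; rewrite -rsubr_ge0 -linearB T0// rsubr_ge0.
Qed.

Lemma positive_labs T x : positive_op T -> labs (T x) <= T (labs x).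
Proof.
move=> T0; apply: labs_le; first by rewrite positive_le// labs_ge.
by rewrite -linearN positive_le// labs_geN.
Qed.

End positive_operators.

(** * Norm bounds and automatic boundedness of positive operators *)

Section bounded_operators.
Context {R : realType}.

Definition bounded_op (V W : normedModType R) (T : V -> W) : Prop :=
  exists2 M : R, 0 < M & forall x, `|T x| <= M * `|x|.

Lemma bounded_op_cvg (V W : normedModType R) (T : {linear V -> W}) (u : nat -> V) l :
  bounded_op T -> u @ \oo --> l -> T \o u @ \oo --> T l.
Proof.
move=> [M M0 TM] /cvgrPdist_le ul; apply/cvgrPdist_le => e e0.
have eM : 0 < e / M by rewrite divr_gt0.
apply: filterS (ul _ eM) => n un /=.
by rewrite -linearB (le_trans (TM _))// mulrC -ler_pdivlMr.
Qed.

Lemma geometric_bound_cvg (V : completeNormedModType R) (u : nat -> V) (K q : R) :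
  0 <= K -> 0 <= q < 1 -> (forall k, `|u k| <= K * q ^+ k) ->
  exists2 l, series u @ \oo --> l & `|l| <= K / (1 - q).
Proof.
move=> K0 /andP[q0 q1] uK.
have q1' : `|q| < 1 by rewrite ger0_norm.
have gc : cvgn (series (geometric K q)) by exact: is_cvg_geometric_series.
have nc : cvgn [normed series u].
  apply: series_le_cvg gc => //= n; first by rewrite mulr_ge0// exprn_ge0.
exists (limn (series u)); first exact: normed_cvg nc.
apply: le_trans (lim_series_norm nc) _.
rewrite -(cvg_lim _ (@cvg_geometric_series _ K q q1'))//.
apply: ler_lim => //; near=> n; rewrite /series/=.
by apply: ler_sum => k _; exact: uK.
Unshelve. all: by end_near. Qed.

(** If [T] is unbounded, vectors with [|T x_n| > 4^n |x_n|] are rescaled to positive [y_n] of norm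
    [2^-n]. The sum [l] of the [y_n] lies above each of them, so [|T l| >= |T y_n| >= 2^n] for all
    [n]. *)
Lemma positive_bounded (X : banachLatticeType R) (T : {linear X -> X}) :
  positive_op T -> bounded_op T.
Proof.
move=> T0; apply: contrapT => nb.
have hx n : exists x : X, 4 ^+ n * `|x| < `|T x|.
  apply: contrapT => h; apply: nb; exists (4 ^+ n); first by rewrite exprn_gt0.
  by move=> x; rewrite leNgt; apply/negP => xT; apply: h; exists x.
have [x xT] := choice hx.
have x0 n : 0 < `|x n|.
  rewrite normr_gt0; apply/eqP => xn0.
  by have := xT n; rewrite xn0 linear0 normr0 mulr0 ltxx.
pose y n := (2 ^+ n * `|x n|)^-1 *: labs (x n).
have y0 n : 0 <= y n.
  by rewrite rscale_ge0 ?labs_ge0// invr_ge0 mulr_ge0// exprn_ge0.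
have ny n : `|y n| <= 1 * 2^-1 ^+ n.
  rewrite mul1r normrZ norm_labs normfV ger0_norm ?mulr_ge0 ?exprn_ge0//.
  by rewrite invfM -mulrA mulVf ?gt_eqF// mulr1 exprVn.
have [||l yl _] := geometric_bound_cvg _ _ ny => //; first lra.
have yle n : y n <= l.
  apply: le_approx => e e0; move/cvgrPdist_le : yl => /(_ _ e0) [m _ ym].
  exists (series y (maxn m n.+1) - l); last first.
    by rewrite distrC; apply: ym => /=; exact: leq_maxl.
  rewrite addrC subrK /series /= (big_nat_widenl _ 0)//=.
  have nm : (n < maxn m n.+1)%N by rewrite leq_maxr.
  rewrite big_mkord (bigD1 (Ordinal nm))//= rlerDl.
  by elim/big_ind : _ => // a b; exact: raddr_ge0.
have Tl n : 2 ^+ n <= `|T l|.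
  apply: le_trans (norm_le (T0 _ (y0 n)) (positive_le T0 (yle n))).
  rewrite linearZ normrZ normfV [`|_ * _|]ger0_norm ?mulr_ge0 ?exprn_ge0//.
  rewrite ler_pdivlMl ?mulr_gt0 ?exprn_gt0//.
  apply: le_trans (labs_le_norm (positive_labs _ T0)).
  by rewrite mulrAC -exprMn -natrM ltW.
have := Tl (Num.bound `|T l|); rewrite leNgt => /negP; apply.
apply: lt_trans (archi_boundP (normr_ge0 _)) _.
by rewrite -natrX ltr_nat ltn_expl.
Qed.

End bounded_operators.

(** * The spectrum of the complexification *)

Section complexified_resolvent.
Context {R : realType} {X : banachLatticeType R}.
Implicit Types (x y : X) (T : {linear X -> X}) (v w : cplx X) (l : R[i]).
Local Open Scope complex_scope.

Local Notation normc := ComplexField.Normc.normc.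

Lemma cplx_norm_le v : cplx_norm v <= `|v.1| + `|v.2|.
Proof.
apply: le_trans (cplx_norm_lb (cplx_ubound_nonempty v)) _.
by apply: le_trans (ler_normD _ _) _; rewrite !norm_labs.
Qed.

Lemma cplx_normE v : `|v| = (cplx_norm v)%:C.
Proof. by []. Qed.

Lemma normcX l n : normc (l ^+ n) = normc l ^+ n.
Proof.
elim: n => [|n IH]; first by rewrite !expr0 ComplexField.Normc.normc1.
by rewrite !exprS ComplexField.Normc.normcM IH.
Qed.

Lemma normc_real (a : R) : normc a%:C = `|a|.
Proof. by rewrite /= expr0n/= addr0 sqrtr_sqr. Qed.

(** Convergence is taken componentwise so that the completeness of [X] serves directly for series in
    the complexification. *)
Definition ccvg (u : nat -> cplx X) v : Prop :=
  fst \o u @ \oo --> v.1 /\ snd \o u @ \oo --> v.2.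

Lemma ccvg_unique u v w : ccvg u v -> ccvg u w -> v = w.
Proof.
move: v w => [v1 v2] [w1 w2] [uv1 uv2] [uw1 uw2].
by congr pair; [exact: norm_cvg_unique uv1 uw1 | exact: norm_cvg_unique uv2 uw2].
Qed.

Lemma ccvg_geometric (u : nat -> cplx X) v (K q : R) : 0 <= q < 1 ->
  (forall n, cplx_norm (u n - v) <= K * q ^+ n) -> ccvg u v.
Proof.
move=> /andP[q0 q1] h.
have q1' : `|q| < 1 by rewrite ger0_norm.
have g0 := @cvg_geometric R K q q1'.
have cv (p : nat -> X) x : (forall n, `|p n - x| <= K * q ^+ n) -> p @ \oo --> x.
  move=> px; apply/subr_cvg0/norm_cvg0P; apply: squeeze_cvgr (cvg_cst 0) g0.
  by near=> n; rewrite normr_ge0 px.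
by split; apply: cv => n; apply: le_trans (h n); case: (le_cplx_norm (u n - v)).
Unshelve. all: by end_near. Qed.

Lemma ccvg_resolvent T l (u : nat -> cplx X) v : bounded_op T -> ccvg u v ->
  ccvg (fun n => l *: u n - cplx_op T (u n)) (l *: v - cplx_op T v).
Proof.
move=> bT; case: l => a b [u1 u2]; split => /=.
  apply: cvgB; last exact: bounded_op_cvg.
  by apply: cvgB; apply: cvgZl_tmp.
apply: cvgB; last exact: bounded_op_cvg.
by apply: cvgD; apply: cvgZl_tmp.
Qed.

Lemma iter_cplx_op T k v :
  iter k (cplx_op T) v = (iter k T v.1, iter k T v.2).
Proof. by elim: k => [|k /= ->]//; case: v. Qed.

(** The inverse is the Neumann series [\sum_k l^-(k+1) T^k]. A bound on real iterates is enough
    because the complexified operator acts componentwise. *)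
Lemma resolvent_set_power_bound T (C s : R) l :
  bounded_op T -> 0 <= C -> 0 <= s ->
  (forall k x, `|iter k T x| <= C * s ^+ k * `|x|) ->
  s < normc l -> resolvent_set (cplx_op T) l.
Proof.
move=> bT C0 s0 Ts sl.
set d := normc l in sl *.
have d0 : 0 < d by exact: le_lt_trans s0 sl.
have l0 : l != 0.
  by apply/eqP => l0; move: d0; rewrite /d l0 ComplexField.Normc.normc0 ltxx.
pose q := s / d.
have q01 : 0 <= q < 1 by rewrite divr_ge0 ?(ltW d0)//= ltr_pdivrMr// mul1r.
have q0 : 0 <= q by case/andP: q01.
pose A : {linear cplx X -> cplx X} := cplx_op T.
pose N v := `|v.1| + `|v.2|.
have N0 v : 0 <= N v by rewrite addr_ge0.
have pow k v : cplx_norm (l^-1 ^+ k *: iter k A v) <= C * N v * q ^+ k.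
  rewrite cplx_normZ normcX ComplexField.Normc.normcV -/d iter_cplx_op.
  rewrite /q expr_div_n -exprVn mulrA [_ * d^-1 ^+ k]mulrC.
  rewrite ler_wpM2l// ?exprn_ge0 ?invr_ge0 ?(ltW d0)//.
  by apply: le_trans (cplx_norm_le _) _; rewrite mulrAC mulrDr lerD//=.
pose u v k := l^-1 ^+ k.+1 *: iter k A v.
pose P v n := \sum_(k < n) u v k.
have uE v k : u v k = l^-1 *: (l^-1 ^+ k *: iter k A v) by rewrite scalerA -exprS.
have lu v k : l *: u v k = l^-1 ^+ k *: iter k A v.
  by rewrite uE [LHS]scalerA mulfV// scale1r.
have uA v k : A (u v k) = l^-1 ^+ k.+1 *: iter k.+1 A v.
  exact: linearZZ.
have unorm v k : cplx_norm (u v k) <= (d^-1 * (C * N v)) * q ^+ k.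
  rewrite uE cplx_normZ ComplexField.Normc.normcV -mulrA.
  by rewrite ler_wpM2l ?invr_ge0 ?(ltW d0).
(* Applying [l - A] to a partial sum telescopes; [PS'] is the same identity on the other side, and
   both remainders decay like [q^n]. *)
have PS v n : l *: P v n - A (P v n) = v - l^-1 ^+ n *: iter n A v.
  elim: n => [|n IH].
    by rewrite /P big_ord0 scaler0 linear0 subr0 expr0 scale1r subrr.
  rewrite /P big_ord_recr -/(P v n) scalerDr linearD opprD addrACA IH.
  by rewrite lu uA addrA subrK.
have PS' v n : P (l *: v - A v) n = v - l^-1 ^+ n *: iter n A v.
  have it k : iter k A (l *: v - A v) = l *: iter k A v - iter k.+1 A v.
    elim: k => [|k IH]//=; rewrite IH.
    by rewrite -/(A _) [LHS]linearB linearZZ.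
  rewrite -PS /P scaler_sumr linear_sum -sumrB; apply: eq_bigr => k _.
  by rewrite lu uA /u it scalerBr [_ *: (l *: _)]scalerA exprSr -mulrA mulVf ?mulr1.
have hB v : exists w, ccvg (P v) w /\ N w <= 2 * (d^-1 * (C * N v) / (1 - q)).
  have h1 k : `|(u v k).1| <= (d^-1 * (C * N v)) * q ^+ k.
    by apply: le_trans (unorm v k); case: (le_cplx_norm (u v k)).
  have h2 k : `|(u v k).2| <= (d^-1 * (C * N v)) * q ^+ k.
    by apply: le_trans (unorm v k); case: (le_cplx_norm (u v k)).
  have K0 : 0 <= d^-1 * (C * N v) by rewrite !mulr_ge0 ?invr_ge0 ?(ltW d0).
  have [w1 c1 n1] := geometric_bound_cvg K0 q01 h1.
  have [w2 c2 n2] := geometric_bound_cvg K0 q01 h2.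
  exists (w1, w2); split; last by rewrite mulrDl !mul1r lerD.
  split => /=.
    rewrite (_ : _ \o _ = series (fun k => (u v k).1))//; apply/funext => n.
    by rewrite /series /= big_mkord /P (big_morph fst (fun _ _ => erefl) erefl).
  rewrite (_ : _ \o _ = series (fun k => (u v k).2))//; apply/funext => n.
  by rewrite /series /= big_mkord /P (big_morph snd (fun _ _ => erefl) erefl).
have [B hBP] := choice hB.
have tel v : ccvg (fun n => v - l^-1 ^+ n *: iter n A v) v.
  apply: (ccvg_geometric q01) => n.
  rewrite addrAC subrr add0r -scaleN1r cplx_normZ.
  rewrite (_ : normc (-1) = 1) ?mul1r; first exact: pow.
  by rewrite (_ : -1 = (-1 : R)%:C) ?normc_real ?normrN1 ?rmorphN1.
have LB : cancel B (fun v => l *: v - A v).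
  move=> v; apply: (@ccvg_unique (fun n => l *: P v n - A (P v n))).
    by apply: ccvg_resolvent => //; have [] := hBP v.
  by under eq_fun do rewrite PS; exact: tel.
have BL : cancel (fun v => l *: v - A v) B.
  move=> v; apply: (@ccvg_unique (P (l *: v - A v))); first by have [] := hBP (l *: v - A v).
  rewrite (_ : P _ = fun n => v - l^-1 ^+ n *: iter n A v); first exact: tel.
  by apply/funext => n; exact: PS'.
have Llin : linear (fun v => l *: v - A v).
  move=> a v w; rewrite [A _]linearP scalerDr opprD addrACA scalerBr !scalerA.
  by rewrite [l * a]mulrC.
pose L : {linear cplx X -> cplx X} :=
  HB.pack (fun v => l *: v - A v) (GRing.isLinear.Build _ _ _ _ _ Llin).
have Blin : linear B by exact: (@can2_linear _ _ _ L B BL LB).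
pose B' : {linear cplx X -> cplx X} :=
  HB.pack B (GRing.isLinear.Build _ _ _ _ _ Blin).
exists B'; split => //.
apply: bounded_linear_continuous; apply/linear_boundedP.
(* The first factor 2 adds up the two components of [B v]; the last one comes from
   [N v <= 2 * cplx_norm v]. *)
pose M := 2 * (d^-1 * C / (1 - q)) * 2.
have BM v : cplx_norm (B v) <= M * cplx_norm v.
  apply: le_trans (cplx_norm_le _) _; have [_ /le_trans] := hBP v; apply.
  have -> : 2 * (d^-1 * (C * N v) / (1 - q)) = 2 * (d^-1 * C / (1 - q)) * N v by ring.
  rewrite /M -[leRHS]mulrA ler_wpM2l//.
    case/andP: q01 => _ q1.
    by rewrite mulr_ge0// divr_ge0 ?mulr_ge0 ?invr_ge0 ?(ltW d0) ?subr_ge0 ?(ltW q1).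
  by rewrite mulrDl mul1r; case: (le_cplx_norm v) => *; exact: lerD.
exists M%:C; split; first by rewrite complex_real.
move=> x Mx v; rewrite !cplx_normE.
apply: le_trans (_ : M%:C * (cplx_norm v)%:C <= _).
  by rewrite -rmorphM lecR.
by rewrite ler_wpM2r ?lecR ?cplx_norm_ge0// ltW.
Qed.
End complexified_resolvent.

(** * Resolvents of positive operators *)

Section real_resolvent.
Context {R : realType} {X : banachLatticeType R}.
Implicit Types (x y u w : X) (T S A B : {linear X -> X}) (l : R[i]) (z s t : R).
Local Open Scope complex_scope.

Local Notation normc := ComplexField.Normc.normc.

Lemma continuous_cplx_bounded (B : {linear cplx X -> cplx X}) : continuous B ->
  exists2 M : R, 0 < M & forall v, cplx_norm (B v) <= M * cplx_norm v.
Proof.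
move=> /linear_bounded_continuous/linear_boundedP [r [rR hr]].
pose M : R := `|complex.Re r| + 1.
exists M; first by rewrite ltr_wpDl.
move=> v; rewrite -lecR rmorphM/=; apply: hr.
have -> : r = (complex.Re r)%:C by rewrite RRe_real.
by rewrite ltcR /M ltr_pwDr// ler_norm.
Qed.

Definition is_resolvent T z B : Prop :=
  [/\ bounded_op B, forall x, B (z *: x - T x) = x
    & forall x, z *: B x - T (B x) = x].

Lemma cplx_realZ z x y : z%:C *: ((x, y) : cplx X) = (z *: x, z *: y).
Proof. by congr pair => /=; rewrite scale0r ?subr0 ?add0r. Qed.

(** As [z - T] preserves real and imaginary parts, the real part of the complex inverse, restricted
    to vectors [(x, 0)], inverts it on [X]. *)
Lemma resolvent_set_real T z :
  resolvent_set (cplx_op T) z%:C -> exists B, is_resolvent T z B.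
Proof.
move=> [B [/continuous_cplx_bounded [M M0 BM] LB BL]].
pose b x := (B (x, 0)).1.
have blin : linear b.
  move=> a x y; rewrite /b.
  have -> : (a *: x + y, 0) = a%:C *: ((x, 0) : cplx X) + (y, 0).
    by rewrite cplx_realZ; congr pair; rewrite /= scaler0 addr0.
  by rewrite linearP; case: (B (x, 0)) => u1 u2 /=; rewrite scale0r subr0.
pose b' : {linear X -> X} := HB.pack b (GRing.isLinear.Build _ _ _ _ _ blin).
exists b'; split => [|x|x] /=.
- exists M => // x; apply: le_trans (_ : cplx_norm (B (x, 0)) <= _).
    by case: (le_cplx_norm (B (x, 0))).
  apply: le_trans (BM _) _; rewrite ler_pM2l//.
  by apply: le_trans (cplx_norm_le _) _; rewrite /= normr0 addr0.
- rewrite /b; have := LB (x, 0); rewrite cplx_realZ => e.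
  rewrite (_ : (z *: x - T x, 0) = (z *: x, z *: 0) - cplx_op T (x, 0) :> cplx X) ?e//.
  by congr pair; rewrite /= !linear0 addr0.
- have := BL (x, 0); rewrite /b; case: (B (x, 0)) => u1 u2; rewrite cplx_realZ.
  by move=> /(congr1 fst).
Qed.

Lemma norm_iter_le A (M : R) : 0 <= M -> (forall x, `|A x| <= M * `|x|) ->
  forall k x, `|iter k A x| <= 1 * M ^+ k * `|x|.
Proof.
move=> M0 AM; elim=> [|k IH] x; first by rewrite expr0 !mul1r.
rewrite iterS (le_trans (AM _))//; apply: le_trans (ler_wpM2l M0 (IH x)) _.
by rewrite !mul1r mulrA -exprS.
Qed.

Lemma spectrum_bounded T : bounded_op T ->
  has_ubound [set normc l | l in spectrum (cplx_op T)].
Proof.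
move=> bT; have [M M0 TM] := bT; exists M => _ [l lT <-].
rewrite leNgt; apply/negP => Ml; apply: lT.
by apply: (@resolvent_set_power_bound _ _ _ 1 M) => //; [exact: ltW|
   exact: norm_iter_le (ltW M0) TM].
Qed.

Lemma resolvent_set_gt T l : bounded_op T ->
  spectral_radius T < normc l -> resolvent_set (cplx_op T) l.
Proof.
move=> bT rl; apply: contrapT => lT.
have := ub_le_sup (spectrum_bounded bT) (_ : _ (normc l)).
by rewrite leNgt rl => /(_ _) h; apply/notF/h; exists l.
Qed.

Lemma spectral_radius_le T s : 0 <= s ->
  (forall l, s < normc l -> resolvent_set (cplx_op T) l) -> spectral_radius T <= s.
Proof.
move=> s0 h; rewrite /spectral_radius.
have [->|/set0P ne] := eqVneq [set normc l | l in spectrum (cplx_op T)] set0.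
  (* An empty spectrum has supremum 0 by convention; this case is settled by [0 <= s]. *)
  by rewrite sup0.
apply: ge_sup => // _ [l lT <-]; rewrite leNgt; apply/negP => /h; exact: lT.
Qed.

Lemma spectral_radius_ge0 T : bounded_op T -> 0 <= spectral_radius T.
Proof.
move=> bT; rewrite /spectral_radius.
have [->|/set0P ne] := eqVneq [set normc l | l in spectrum (cplx_op T)] set0.
  by rewrite sup0.
have [_ [l lT _]] := ne; apply: (@le_trans _ _ (normc l)); first by case: l {lT} => a b; exact: sqrtr_ge0.
by apply: ub_le_sup; [exact: spectrum_bounded | exists l].
Qed.

(** The negative part [w] of [B x] satisfies [z w <= T w], since [z (- B x) = - x - T (B x) <= T w].
    Positivity of a resolvent thus reduces to the absence of such subeigenvectors [w]. *)
Lemma resolvent_ge0 T z B : 0 < z -> positive_op T -> is_resolvent T z B ->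
  (forall w, 0 <= w -> z *: w <= T w -> w = 0) -> positive_op B.
Proof.
move=> z0 T0 [_ BL LB] h x x0.
have u0 : ppart (- B x) = 0.
  apply: h; first exact: ppart_ge0.
  rewrite -ppartZ ?(ltW z0)// scalerN.
  have -> : z *: B x = x + T (B x) by rewrite -[X in X + _]LB subrK.
  apply: ppart_lub; last by rewrite T0 ?ppart_ge0.
  apply: le_trans (_ : - T (B x) <= _); first by rewrite rleN2 rlerDr.
  by rewrite -linearN positive_le// ppart_ge.
by rewrite -(ppartB (B x)) u0 subr0 ppart_ge0.
Qed.

(** Positivity at [s] propagates to the left: from [z w <= T w] follows [s w - T w <= (s - z) w],
    and the positive [B] turns this into [w <= (s - z) B w], where the right side is a strict
    contraction. *)
Lemma resolvent_ge0_near T s B z (M : R) : positive_op B -> is_resolvent T s B ->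
  (forall x, `|B x| <= M * `|x|) -> z <= s -> (s - z) * M < 1 ->
  forall w, 0 <= w -> z *: w <= T w -> w = 0.
Proof.
move=> B0 [_ BL LB] BM zs sz w w0 wT; apply/eqP; rewrite -normr_le0 leNgt.
apply/negP => w'0.
have : w <= (s - z) *: B w.
  rewrite -linearZZ -{1}(BL w); apply: positive_le => //.
  by rewrite scalerBl rleBlDr -addrA rlerDl addrC rsubr_ge0.
move=> /(norm_le w0); rewrite normrZ ger0_norm ?subr_ge0// => h.
have {}h := le_trans h (ler_wpM2l (_ : 0 <= s - z) (BM w)).
have : `|w| < `|w|.
  apply: le_lt_trans (h _) _; first by rewrite subr_ge0.
  by rewrite mulrA gtr_pMl.
by rewrite ltxx.
Qed.

(** The points above the spectral radius without a positive resolvent are bounded by the norm of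
    [T]. Just above their supremum the resolvent is positive, and [resolvent_ge0_near] carries
    positivity past a point of the set close to the supremum. *)
Lemma positive_resolvent T z : positive_op T -> spectral_radius T < z ->
  exists2 B, is_resolvent T z B & positive_op B.
Proof.
move=> T0 rz; have bT := positive_bounded T0; have [M M0 TM] := bT.
have r0 := spectral_radius_ge0 bT.
have res s : spectral_radius T < s -> exists B, is_resolvent T s B.
  move=> rs; apply: resolvent_set_real; apply: resolvent_set_gt => //.
  by rewrite normc_real ger0_norm// (le_trans r0 (ltW rs)).
pose F := [set s | spectral_radius T < s /\
                   ~ exists2 B, is_resolvent T s B & positive_op B].
apply: contrapT => nz.
have Fz : F z by [].
have FM : has_ubound F.
  exists M => s [rs ns]; rewrite leNgt; apply/negP => Ms; apply: ns.
  have [B sB] := res _ rs; exists B => //.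
  apply: (resolvent_ge0 _ T0 sB) => [|w w0 wT]; first exact: lt_trans Ms.
  apply/eqP; rewrite -normr_le0 leNgt; apply/negP => w'0.
  have : `|s *: w| <= `|T w| by rewrite norm_le// rscale_ge0// ltW// (lt_trans M0).
  rewrite normrZ ger0_norm; last by rewrite ltW// (lt_trans M0).
  by move=> /le_trans/(_ (TM _)); rewrite ler_pM2r// leNgt Ms.
pose s := sup F.
have zs : z <= s by exact: ub_le_sup.
have [B sB] := res _ (lt_le_trans rz zs).
have [[b b0 Bb] BL LB] := sB.
(* With [b e = 1/8], the resolvent [C] at [s + e] has norm at most [2 b], and a point [s'] within
   [e] below [s] satisfies [(s + e - s') * (2 b) < 4 b e = 1/2]. Only a norm bound is used for the
   resolvent [B] at the supremum [s], as its sign is unknown. *)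
pose e : R := (8 * b)^-1.
have e0 : 0 < e by rewrite invr_gt0 mulr_gt0.
have eb : b * e = 8^-1 by rewrite /e invfM mulrCA mulfV ?gt_eqF// mulr1.
have [||s' Fs' ss'] := @sup_adherent _ F e => //; first by split => //; exists z.
have s's : s' <= s by exact: ub_le_sup.
have [C sC C0] : exists2 C, is_resolvent T (s + e) C & positive_op C.
  apply: contrapT => nC.
  have : F (s + e) by split => //; rewrite (lt_trans rz)// ltr_pwDr.
  by move=> /(ub_le_sup FM); rewrite -/s gerDl leNgt e0.
have Cb x : `|C x| <= 2 * b * `|x|.
  have [_ _ LC] := sC.
  have E : s *: C x - T (C x) = x - e *: C x.
    by rewrite -[X in _ = X - _]LC scalerDl addrAC addrK.
  have : `|C x| <= b * (`|x| + e * `|C x|).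
    rewrite -{1}(BL (C x)) E; apply: le_trans (Bb _) _; rewrite ler_pM2l//.
    by apply: le_trans (ler_normB _ _) _; rewrite normrZ gtr0_norm.
  rewrite mulrDr mulrA eb => h; have := normr_ge0 (C x); have : 0 <= b * `|x|.
    by rewrite mulr_ge0// ltW.
  move: h; set c := `|C x|; set d := `|x|; lra.
case: Fs' => rs' []; have [B' sB'] := res _ rs'; exists B' => //.
apply: (resolvent_ge0 _ T0 sB'); first exact: le_lt_trans rs'.
apply: (resolvent_ge0_near C0 sC Cb); first by rewrite (le_trans s's)// lerDl ltW.
have h : s + e - s' < 2 * e by move: ss'; rewrite -/s; lra.
apply: lt_trans (_ : 2 * e * (2 * b) < 1); first by rewrite ltr_pM2r// mulr_gt0.
have -> : 2 * e * (2 * b) = 4 * (b * e) by ring.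
rewrite eb; lra.
Qed.

Lemma iter_positive T k : positive_op T -> positive_op (iter k T).
Proof. by move=> T0 x x0; elim: k => //= k IH; exact: T0. Qed.

Lemma iterZ T k (a : R) x : iter k T (a *: x) = a *: iter k T x.
Proof. by elim: k => //= k ->; rewrite linearZZ. Qed.

Lemma iter_le T k x y : positive_op T -> x <= y -> iter k T x <= iter k T y.
Proof. by move=> T0 xy; elim: k => //= k IH; exact: positive_le. Qed.

Lemma iter_labs T k x : positive_op T -> labs (iter k T x) <= iter k T (labs x).
Proof.
move=> T0; elim: k => //= k IH; apply: le_trans (positive_labs _ T0) _.
exact: positive_le.
Qed.

Lemma norm_positive_le T (M : R) : positive_op T ->
  (forall x, 0 <= x -> `|T x| <= M * `|x|) -> forall x, `|T x| <= M * `|x|.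
Proof.
move=> T0 h x; apply: le_trans (labs_le_norm (positive_labs _ T0)) _.
by rewrite -[in leRHS]norm_labs h// labs_ge0.
Qed.

(** Otherwise [S - r] is bounded below by [e] on the positive cone, so the positive resolvents just
    above [r] have norm at most [2 / e]. A Neumann series then yields a positive right inverse of
    [s - S] for some [s < r]; by positivity it forces [S^k] to be of order [s^k], against the value
    of the spectral radius. *)
Lemma approx_eigenvector S (e : R) : positive_op S -> 0 < spectral_radius S ->
  0 < e -> exists u, [/\ 0 <= u, `|u| = 1 & `|S u - spectral_radius S *: u| <= e].
Proof.
set r := spectral_radius S => S0 r0 e0; apply: contrapT => nu.
have lb u : 0 <= u -> e * `|u| <= `|S u - r *: u|.
  move=> u0; have [->|un0] := eqVneq u 0; first by rewrite normr0 mulr0.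
  have u'0 : 0 < `|u| by rewrite normr_gt0.
  rewrite leNgt; apply/negP => h; apply: nu; exists (`|u|^-1 *: u); split.
  - by rewrite rscale_ge0// invr_ge0.
  - by rewrite normrZ normfV normr_id mulVf// gt_eqF.
  rewrite linearZZ scalerA mulrC -scalerA -scalerBr normrZ normfV normr_id.
  by rewrite mulrC ler_pdivrMr// ltW.
(* The bound [e / 8] gives [2 t B] norm at most [2 * (e / 8) * (2 / e) = 1/2]; the bound [r / 2]
   keeps [s = r - t] positive. *)
pose t := Num.min (e / 8) (r / 2).
have t0 : 0 < t by rewrite lt_min !divr_gt0.
have te : t <= e / 8 by rewrite ge_min lexx.
have tr : t <= r / 2 by rewrite ge_min lexx orbT.
have rz : spectral_radius S < r + t by rewrite ltrDl.
have [B [bB BL LB] B0] := positive_resolvent S0 rz.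
have Be : forall x, `|B x| <= 2 / e * `|x|.
  apply: norm_positive_le => // x x0.
  have E : S (B x) - r *: B x = t *: B x - x.
    by rewrite -[X in _ = _ - X]LB scalerDl opprB opprD addrCA (addrCA (t *: _)) subrr addr0.
  have := lb _ (B0 _ x0); rewrite E => h.
  have {}h := le_trans h (ler_normB _ _).
  rewrite mulrAC ler_pdivlMr//.
  move: h; rewrite normrZ gtr0_norm// => h.
  have : t * `|B x| <= e / 8 * `|B x| by rewrite ler_wpM2r.
  move: (normr_ge0 (B x)); have : 0 <= e * `|B x| by rewrite mulr_ge0// ltW.
  move: h; rewrite [`|B x| * e]mulrC; set c := `|B x|; set d := `|x|.
  have -> : e / 8 * c = (e * c) / 8 by ring.
  lra.
pose A : {linear X -> X} := (2 * t) \*: B.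
have AE x : A x = (2 * t) *: B x by [].
have Ah x : `|A x| <= 2^-1 * `|x|.
  rewrite AE normrZ gtr0_norm ?mulr_gt0//.
  apply: le_trans (ler_wpM2l _ (Be x)) _; first by rewrite mulr_ge0// ltW.
  rewrite mulrA ler_wpM2r//.
  have -> : 2^-1 = 2 * (e / 8) * (2 / e) :> R by field; rewrite gt_eqF.
  by rewrite ler_wpM2r ?divr_ge0 ?(ltW e0)// ler_wpM2l.
have bA : bounded_op A by exists 2^-1.
have A0 : positive_op A by move=> x x0; rewrite AE rscale_ge0 ?B0// mulr_ge0// ltW.
have [G sG] : exists G, is_resolvent A 1 G.
  apply: resolvent_set_real.
  apply: (@resolvent_set_power_bound _ _ _ 1 2^-1) => //.
    by apply: norm_iter_le.
  by rewrite normc_real normr1; lra.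
have G0 : positive_op G.
  apply: (resolvent_ge0 _ A0 sG) => // w w0; rewrite scale1r => wA.
  apply/eqP; rewrite -normr_le0; have := le_trans (norm_le w0 wA) (Ah w).
  by move: (normr_ge0 w); lra.
have [[g g0 Gg] _ LG] := sG.
pose s := r - t.
have s0 : 0 < s by rewrite /s; lra.
(* [Y = (1 - 2 t B)^-1 B] is the candidate for [R(r - t, S)], reached from [r + t] by a shift of
   [2 t]. *)
pose Y x := G (B x).
have YE x : s *: Y x - S (Y x) = x.
  have Y1 : Y x = B (x + (2 * t) *: Y x).
    rewrite linearD linearZZ -AE -/(Y x).
    by have := LG (B x); rewrite scale1r -/(Y x) => /eqP; rewrite subr_eq => /eqP.
  have := LB (x + (2 * t) *: Y x); rewrite -Y1 => /eqP; rewrite -subr_eq => /eqP; apply: etrans.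
  by rewrite addrAC -scalerBl; congr (_ *: _ - _); rewrite /s; ring.
have Y0 x : 0 <= x -> 0 <= Y x by move=> x0; rewrite G0// B0.
(* For [x >= 0], the identity [s Y x - S (Y x) = x] gives both [x <= s Y x] and [S (Y x) <= s Y x],
   hence [S^k x <= s * s^k Y x]. *)
have pow k x : `|iter k S x| <= s * (g * (2 / e)) * s ^+ k * `|x|.
  wlog x0 : x / 0 <= x => [hw|].
    apply: le_trans (labs_le_norm (iter_labs k x S0)) _.
    by rewrite -[in leRHS]norm_labs hw// labs_ge0.
  have SY : S (Y x) <= s *: Y x by rewrite -rsubr_ge0 YE.
  have xY : x <= s *: Y x by rewrite -{1}(YE x) rlerBl S0// Y0.
  have ks : iter k S (Y x) <= s ^+ k *: Y x.
    elim: (k) => [|n IH]; first by rewrite expr0 scale1r.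
    rewrite iterS; apply: le_trans (positive_le S0 IH) _.
    by rewrite linearZZ exprSr -scalerA rscale_le// exprn_ge0// ltW.
  have h : iter k S x <= s *: (s ^+ k *: Y x).
    apply: le_trans (iter_le k S0 xY) _.
    by rewrite iterZ rscale_le// ltW.
  apply: le_trans (norm_le (iter_positive k S0 x0) h) _.
  rewrite !normrZ normrX (gtr0_norm s0).
  have -> : s * (g * (2 / e)) * s ^+ k * `|x| = s * (s ^+ k * (g * (2 / e * `|x|))) by ring.
  rewrite !ler_wpM2l ?exprn_ge0 ?(ltW s0)//.
  by apply: le_trans (Gg _) _; rewrite ler_wpM2l ?(ltW g0).
have : spectral_radius S <= s.
  apply: spectral_radius_le; first exact: ltW.
  move=> l sl; apply: (@resolvent_set_power_bound _ _ _ (s * (g * (2 / e))) s) => //.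
  - exact: positive_bounded.
  - by rewrite !mulr_ge0 ?invr_ge0// ltW.
  - exact: ltW.
by rewrite -/r /s lerBrDr gerDl leNgt t0.
Qed.

End real_resolvent.

(** * Poles of the resolvent *)

Section poles.
Context {R : realType} {X : banachLatticeType R}.
Implicit Types (x y u w : X) (T S A B Q : {linear X -> X}) (l : R[i]) (z s t : R).
Local Open Scope complex_scope.

Local Notation normc := ComplexField.Normc.normc.

(** [Q] is the trace on [X] of the leading Laurent coefficient at a pole of order [n.+1]. The last
    clause is what the Laurent expansion leaves on the half-line to the right of [r]: convergence in
    operator norm at a linear rate. *)
Definition pole_coefficient T r n Q : Prop :=
  [/\ bounded_op Q, exists x, Q x != 0
    & exists M d : R, 0 < d /\ forall t B, 0 < t < d -> is_resolvent T (r + t) B ->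
        forall x, `|t ^+ n.+1 *: B x - Q x| <= M * t * `|x|].

Lemma resolvent_complexified T B z : is_resolvent T z B ->
  resolvent (cplx_op T) z%:C =1 cplx_op B.
Proof.
move=> [_ BL LB] [x y]; rewrite /resolvent.
have E v : z%:C *: v - cplx_op T v = (z *: v.1 - T v.1, z *: v.2 - T v.2).
  by case: v => a b; rewrite cplx_realZ.
have h : [set v | z%:C *: v - cplx_op T v = (x, y)] (cplx_op B (x, y)).
  by rewrite /= E /= !LB.
have := xgetPex 0 (ex_intro _ _ h); set v := xget _ _; rewrite /= E => -[v1 v2].
by rewrite [LHS]surjective_pairing -(BL v.1) -(BL v.2) v1 v2.
Qed.

Lemma cplx_normN (v : cplx X) : cplx_norm (- v) = cplx_norm v.
Proof.
rewrite -scaleN1r cplx_normZ [normc (-1)](_ : _ = 1) ?mul1r//.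
by rewrite (_ : -1 = (-1 : R)%:C) ?normc_real ?normrN1 ?rmorphN1.
Qed.

Lemma geometric_sum_le (q : R) N : 0 <= q <= 2^-1 ->
  \sum_(k < N) q ^+ k.+1 <= 2 * q.
Proof.
move=> /andP[q0 q2]; have h m : \sum_(k < m) q ^+ k.+1 <= 2 * q - 2 * q * 2^-1 ^+ m.
  elim: m => [|m IH]; first by rewrite big_ord0 expr0 mulr1 subrr.
  rewrite big_ord_recr /=; apply: le_trans (lerD IH (_ : _ <= q * 2^-1 ^+ m)) _.
    by rewrite exprS ler_wpM2l// lerXn2r// nnegrE// invr_ge0.
  rewrite exprS; set c := 2^-1 ^+ m; have -> : 2 * q * (2^-1 * c) = q * c by field.
  lra.
by apply: le_trans (h N) _; rewrite gerBl !mulr_ge0// exprn_ge0// invr_ge0.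
Qed.

(** Convergence of the Laurent series at a single [t1] bounds [t1^k C_k] uniformly in [k]. For
    [t <= t1 / 2] the terms after the leading one are then dominated by a geometric series in
    [t / t1], which gives the linear rate. *)
Lemma pole_coefficient_exists T r : is_pole_of_resolvent T r ->
  exists n Q, pole_coefficient T r n Q.
Proof.
move=> [n [C [cC [v0 C0v0] near]]].
have [d d0 hd] : exists2 d : R, 0 < d & forall t, 0 < t < d ->
    resolvent_set (cplx_op T) (r + t)%:C /\
    forall e : R, 0 < e -> exists N0, forall N v, (N0 <= N)%N ->
      cplx_norm (\sum_(k < N) (t%:C) ^ (k%:Z - n.+1%:Z) *: C k v -
                 resolvent (cplx_op T) (r + t)%:C v) <= e * cplx_norm v.
  move: near; rewrite /dnbhs /= => /nbhs_ballP [e /= e0 he].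
  have e'0 : 0 < complex.Re e by move: e0; case: (e) => a b; rewrite ltcE/= => /andP[].
  have eE : e = (complex.Re e)%:C by rewrite RRe_real// gtr0_real.
  exists (complex.Re e) => // t /andP[t0 te].
  have [| |h1 h2] := he (r + t)%:C.
  - rewrite /ball_ /= eE rmorphD opprD addrA subrr add0r normrN.
    by rewrite -[`|_|]/((normc t%:C)%:C) normc_real gtr0_norm// ltcR.
  - by apply/eqP => /complexI/eqP; rewrite -subr_eq0 addrAC subrr add0r gt_eqF.
  split => // f f0; have [|N0 _ hN0] := h2 f%:C; first by rewrite ltcR.
  exists N0 => N v N0N; have := hN0 N N0N v.
  by rewrite rmorphD addrAC subrr add0r !cplx_normE -rmorphM lecR.
pose t1 := d / 2.
have t10 : 0 < t1 by rewrite divr_gt0.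
have t1d : t1 < d by rewrite /t1; lra.
have tz t k v : 0 < t -> t%:C ^+ n.+1 *: (t%:C ^ (k%:Z - n.+1%:Z) *: C k v) =
    t%:C ^+ k *: C k v.
  move=> t0; rewrite scalerA; congr (_ *: _).
  rewrite exprnP -expfzDr ?subrKC//.
  by apply/eqP => /complexI/eqP; rewrite gt_eqF.
have tn t k v : 0 < t -> cplx_norm (t%:C ^+ k *: v) = t ^+ k * cplx_norm v.
  by move=> t0; rewrite cplx_normZ normcX normc_real gtr0_norm.
have [D D0 hD] : exists2 D : R, 0 < D & forall k v,
    t1 ^+ k * cplx_norm (C k v) <= D * cplx_norm v.
  have [|_ h] := hd t1; first by rewrite t10.
  have [N0 hN0] := h 1 ltr01.
  have [D1 D10 hD1] : exists2 D : R, 0 < D & forall k v, (k < N0)%N ->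
      t1 ^+ k * cplx_norm (C k v) <= D * cplx_norm v.
    elim: (N0) => [|m [D D0 IH]]; first by exists 1.
    have [M M0 hM] := continuous_cplx_bounded (cC m).
    exists (D + t1 ^+ m * M); first by rewrite addr_gt0// mulr_gt0// exprn_gt0.
    move=> k v; rewrite ltnS leq_eqVlt => /predU1P[->|km]; rewrite mulrDl.
      rewrite ler_wpDl ?mulr_ge0 ?(ltW D0) ?cplx_norm_ge0//.
      by rewrite -mulrA ler_wpM2l ?exprn_ge0 ?(ltW t10).
    rewrite ler_wpDr ?IH// !mulr_ge0 ?exprn_ge0 ?(ltW t10) ?(ltW M0)//.
    exact: cplx_norm_ge0.
  (* From the index [N0] on, a term is the difference of two partial sums, each within [|v|] of the
     resolvent at [v]; hence the factor 2. [D1] covers the finitely many earlier coefficients. *)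
  exists (D1 + 2 * t1 ^+ n.+1); first by rewrite addr_gt0// mulr_gt0// exprn_gt0.
  move=> k v; rewrite mulrDl; have [kN|Nk] := ltnP k N0.
    by rewrite ler_wpDr ?hD1// !mulr_ge0 ?exprn_ge0 ?cplx_norm_ge0 ?(ltW t10).
  rewrite ler_wpDl ?mulr_ge0 ?cplx_norm_ge0 ?(ltW D10)//.
  have := cplx_norm_triangle (\sum_(i < k.+1) t1%:C ^ (i%:Z - n.+1%:Z) *: C i v -
    resolvent (cplx_op T) (r + t1)%:C v) (- (\sum_(i < k) t1%:C ^ (i%:Z - n.+1%:Z) *: C i v -
    resolvent (cplx_op T) (r + t1)%:C v)).
  rewrite cplx_normN opprB addrA subrK [X in X - _]big_ord_recr /= addrAC subrr add0r => h1.
  have := le_trans h1 (lerD (hN0 k.+1 v (leqW Nk)) (hN0 k v Nk)).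
  rewrite -mulrDl => h2.
  rewrite -tn// -(tz _ _ _ t10) tn// [2 * _]mulrC -mulrA ler_wpM2l//.
  by rewrite exprn_ge0// ltW.
have main t v : 0 < t <= t1 / 2 -> cplx_norm (t%:C ^+ n.+1 *:
    resolvent (cplx_op T) (r + t)%:C v - C 0%N v) <= 3 * D / t1 * t * cplx_norm v.
  move=> /andP[t0 tt1]; have [|_ h] := hd t; first by rewrite t0 /t1; lra.
  pose q := t / t1.
  have q0 : 0 < q by rewrite divr_gt0.
  have q2 : q <= 2^-1 by rewrite /q ler_pdivrMr// mulrC.
  (* The truncation error, once multiplied by [t^(n+1)], is at most [q D |v|]. Together with the
     [2 q D |v|] of the geometric sum this produces the constant 3. *)
  have [|N0 hN0] := h (q * D / t ^+ n.+1); first exact: divr_gt0 (mulr_gt0 q0 D0) (exprn_gt0 _ t0).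
  have {}hN0 := hN0 N0.+1 v (leqnSn _).
  set L := resolvent _ _ v in hN0 *; set F := \sum_(k < N0.+1) _ in hN0.
  have -> : t%:C ^+ n.+1 *: L - C 0%N v =
      (t%:C ^+ n.+1 *: F - C 0%N v) + - (t%:C ^+ n.+1 *: (F - L)).
    by rewrite scalerBr opprB [RHS]addrC addrA subrK.
  apply: le_trans (cplx_norm_triangle _ _) _.
  rewrite cplx_normN tn//.
  have -> : 3 * D / t1 * t * cplx_norm v =
      2 * q * (D * cplx_norm v) + q * D * cplx_norm v by rewrite /q; ring.
  apply: lerD; last first.
    rewrite mulrC -ler_pdivlMr ?exprn_gt0//; apply: le_trans hN0 _.
    by rewrite mulrAC.
  have -> : t%:C ^+ n.+1 *: F - C 0%N v = \sum_(k < N0) t%:C ^+ k.+1 *: C k.+1 v.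
    rewrite /F big_ord_recl scalerDr tz// expr0 scale1r addrAC subrr add0r.
    by rewrite scaler_sumr; apply: eq_bigr => k _; rewrite tz.
  apply: le_trans (_ : \sum_(k < N0) q ^+ k.+1 * (D * cplx_norm v) <= _).
    elim/big_ind2 : _ => [|a a' b b' ha hb|k _].
    - by apply: le_trans (cplx_norm_le _) _; rewrite !normr0 addr0.
    - by apply: le_trans (cplx_norm_triangle _ _) _; exact: lerD.
    rewrite tn// /q expr_div_n -mulrA ler_wpM2l ?exprn_ge0 ?(ltW t0)//.
    by rewrite mulrC ler_pdivlMr ?exprn_gt0// mulrC.
  rewrite -mulr_suml ler_wpM2r ?mulr_ge0 ?(ltW D0) ?cplx_norm_ge0//.
  by rewrite geometric_sum_le// q2 ltW.
pose Qf x := (C 0%N (x, 0)).1.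
have Qlin : linear Qf.
  move=> a x y; rewrite /Qf.
  have -> : (a *: x + y, 0) = a%:C *: ((x, 0) : cplx X) + (y, 0).
    by rewrite cplx_realZ; congr pair; rewrite /= scaler0 addr0.
  by rewrite linearP; case: (C 0%N (x, 0)) => u1 u2 /=; rewrite scale0r subr0.
pose Q : {linear X -> X} := HB.pack Qf (GRing.isLinear.Build _ _ _ _ _ Qlin).
have nx0 x : cplx_norm (x, 0) <= `|x|.
  by apply: le_trans (cplx_norm_le _) _; rewrite /= normr0 addr0.
have KK t : 0 < t -> 0 <= 3 * D / t1 * t.
  by move=> t0; rewrite !mulr_ge0 ?invr_ge0// ltW.
have est t B : 0 < t < t1 / 2 -> is_resolvent T (r + t) B -> forall x,
    `|t ^+ n.+1 *: B x - Q x| <= 3 * D / t1 * t * `|x| /\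
    `|(C 0%N (x, 0)).2| <= 3 * D / t1 * t * `|x|.
  move=> /andP[t0 tt] tB x.
  have := main t (x, 0) _; rewrite t0 ltW// => /(_ isT).
  rewrite (resolvent_complexified tB) /cplx_op /= linear0 -rmorphXn cplx_realZ scaler0.
  set w := _ - _ => h; have {}h := le_trans h (ler_wpM2l (KK _ t0) (nx0 x)).
  have [w1 w2] := le_cplx_norm w.
  split; first exact: le_trans w1 h.
  by apply: le_trans h; apply: le_trans w2; rewrite /w /= sub0r normrN.
have res t : 0 < t < t1 / 2 -> exists B, is_resolvent T (r + t) B.
  move=> /andP[t0 tt]; apply: resolvent_set_real.
  by case: (hd t) => //; rewrite t0 /t1; lra.
(* Resolvents at real points map real vectors to real vectors, so the imaginary part of the limit is
   within a multiple of [t] of 0 for every small [t]. *)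
have C2 x : (C 0%N (x, 0)).2 = 0.
  apply/eqP; rewrite -normr_le0; apply/ler_addgt0Pl => e e0; rewrite addr0.
  pose K := 3 * D / t1 * `|x|.
  have K0 : 0 <= K by rewrite !mulr_ge0 ?invr_ge0// ltW.
  pose t := Num.min (t1 / 4) (e / (K + 1)).
  have tt : 0 < t < t1 / 2.
    by rewrite lt_min gt_min !divr_gt0 ?ltr_wpDl//=; apply/orP; left; lra.
  have [B tB] := res _ tt; have [_ h] := est _ _ tt tB x.
  apply: le_trans h _; rewrite mulrAC -/K.
  apply: le_trans (_ : K * (e / (K + 1)) <= _).
    by rewrite ler_wpM2l// ge_min lexx orbT.
  rewrite mulrA ler_pdivrMr ?ltr_wpDl// mulrC ler_pM2l//; lra.
exists n, Q; split.
- have [M M0 hM] := continuous_cplx_bounded (cC 0%N); exists M => // x.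
  apply: le_trans (_ : cplx_norm (C 0%N (x, 0)) <= _).
    by case: (le_cplx_norm (C 0%N (x, 0))).
  by apply: le_trans (hM _) _; rewrite ler_pM2l.
- apply: contrapT => nQ; move/eqP: C0v0; apply.
  have Q0 x : Q x = 0 by apply: contrapT => /eqP Qx; apply: nQ; exists x.
  have C0 x : C 0%N (x, 0) = 0.
    by rewrite [LHS]surjective_pairing C2 -[(C 0%N _).1]/(Q x) Q0.
  case: v0 => x y.
  have -> : (x, y) = (x, 0) + (Complex 0 1) *: ((y, 0) : cplx X).
    by congr pair; rewrite /= ?scale0r ?scale1r ?scaler0 ?subr0 ?addr0 ?add0r.
  by rewrite linearD linearZZ !C0 scaler0 addr0.
exists (3 * D / t1), (t1 / 2); split; first by rewrite divr_gt0.
by move=> t B tt tB x; have [] := est _ _ tt tB x.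
Qed.

End poles.

(** * Ideals and bands *)

Section ideals_and_bands.
Context {R : realType} {X : banachLatticeType R}.
Implicit Types (x y z e u w : X) (T S D Q : {linear X -> X}) (a c r : R).

Local Notation meet := (@Order.meet ring_display X).

Lemma labs0 : labs (0 : X) = 0.
Proof. by rewrite labs_ge0_id. Qed.

Lemma labs_id x : labs (labs x) = labs x.
Proof. by rewrite labs_ge0_id ?labs_ge0. Qed.

Lemma meet_le2 x y z w : x <= y -> z <= w -> meet x z <= meet y w.
Proof.
move=> xy zw; rewrite lexI (le_trans (leIl _ _) xy)/=.
exact: le_trans (leIr _ _) zw.
Qed.

Lemma meet_eq0_le x y z : 0 <= x -> 0 <= y -> y <= z -> meet x z = 0 -> meet x y = 0.
Proof.
move=> x0 y0 yz xz; apply/eqP; rewrite eq_le meet_ge0// andbT -xz.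
exact: meet_le2.
Qed.

Lemma op_le_positive_le S T x : op_le S T -> 0 <= x -> S x <= T x.
Proof. by move=> ST x0; rewrite -rsubr_ge0; exact: ST. Qed.

(* For 0 <= e, this is the closure of the ideal generated by e. *)
Definition closed_ideal e : set X := [set x | forall a : R, 0 < a ->
  exists2 c : R, 0 <= c & `|ppart (labs x - c *: e)| <= a].

Lemma closed_ideal_gen e : 0 <= e -> closed_ideal e e.
Proof.
move=> e0 a a0; exists 1 => //; rewrite scale1r labs_ge0_id// subrr.
by rewrite ge0_ppart// normr0 ltW.
Qed.

Lemma closed_ideal_order_ideal e : order_ideal (closed_ideal e).
Proof.
split => [a a0|x y Ix Iy a a0|b x Ix a a0|x y xy Iy a a0].
- by exists 0 => //; rewrite labs0 scale0r subr0 ge0_ppart// normr0 ltW.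
- have a2 : 0 < a / 2 by rewrite divr_gt0.
  have [c c0 xc] := Ix _ a2; have [d d0 yd] := Iy _ a2.
  exists (c + d); first exact: addr_ge0.
  apply: le_trans (_ : `|ppart (labs x - c *: e) + ppart (labs y - d *: e)| <= _).
    rewrite norm_le ?ppart_ge0//; apply: le_trans (ppartD _ _).
    by apply: ppart_le; rewrite scalerDl opprD addrACA rleD2r labsD.
  apply: le_trans (ler_normD _ _) _; rewrite (splitr a); exact: lerD.
- have b0 : 0 < `|b| + 1 by rewrite ltr_wpDl.
  have [c c0 xc] := Ix (a / (`|b| + 1)) (divr_gt0 a0 b0).
  exists (`|b| * c); first by rewrite mulr_ge0.
  rewrite labsZ -scalerA -scalerBr ppartZ// normrZ normr_id.
  apply: le_trans (ler_wpM2l (normr_ge0 b) xc) _.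
  by rewrite mulrCA ger_pMr// ler_pdivrMr// mul1r lerDl.
- have [c c0 yc] := Iy _ a0; exists c => //; apply: (le_trans _ yc).
  by rewrite norm_le ?ppart_ge0// ppart_le// rleD2r.
Qed.

Lemma closed_ideal_closed e : closed (closed_ideal e).
Proof.
move=> x cx a a0; have a2 : 0 < a / 2 by rewrite divr_gt0.
have [y [Iy]] := cx _ (nbhsx_ballx x _ a2).
rewrite -ball_normE /= => xy.
have [c c0 yc] := Iy _ a2; exists c => //.
apply: le_trans (_ : `|ppart (labs y - c *: e)| + `|labs (x - y)| <= _).
  apply: ppart_norm_le; rewrite addrAC rleD2r addrC -{1}(subrK y x).
  exact: labsD.
by rewrite norm_labs (splitr a) lerD// ltW.
Qed.

Lemma closed_ideal_invariant T e r : positive_op T -> bounded_op T -> 0 <= r ->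
  T e = r *: e -> T @` closed_ideal e `<=` closed_ideal e.
Proof.
move=> T0 [M M0 TM] r0 Te _ [x Ix <-] a a0.
have [c c0 xc] := Ix _ (divr_gt0 a0 M0).
exists (c * r); first exact: mulr_ge0.
apply: le_trans (_ : `|T (ppart (labs x - c *: e))| <= _).
  rewrite norm_le ?ppart_ge0// ppart_lub ?T0 ?ppart_ge0// rleBlDr.
  rewrite -scalerA -Te -linearZZ -linearD.
  apply: le_trans (positive_labs _ T0) _; apply: positive_le => //.
  by rewrite -rleBlDr ppart_ge.
by apply: le_trans (TM _) _; rewrite mulrC -ler_pdivlMr.
Qed.

Definition weak_unit e : Prop := forall z, 0 <= z -> meet z e = 0 -> z = 0.

Lemma ideal_irreducible_total T e r : ideal_irreducible T -> bounded_op T ->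
  0 <= r -> 0 <= e -> e != 0 -> T e = r *: e -> forall x, closed_ideal e x.
Proof.
move=> [T0 irr] bT r0 e0 en0 Te x.
have [I0|->//] := irr _ (closed_ideal_order_ideal e) (@closed_ideal_closed e)
  (closed_ideal_invariant T0 bT r0 Te).
have : closed_ideal e e by exact: closed_ideal_gen.
by rewrite I0 /= => /eqP; rewrite (negbTE en0).
Qed.

(** If [z] is disjoint from [e], then subtracting a multiple of [e] leaves the positive part
    unchanged: [ppart (z - c e) = z]. So [z] cannot be approximated from the ideal of [e] unless it
    is 0. *)
Lemma closed_ideal_weak_unit e : 0 <= e -> (forall x, closed_ideal e x) ->
  weak_unit e.
Proof.
move=> e0 he z z0 ze; apply/eqP; rewrite -normr_le0.
apply/ler_addgt0Pl => a a0; rewrite addr0.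
have [c c0] := he z _ a0; rewrite labs_ge0_id// -subr_meet meetZ_eq0//.
by rewrite subr0.
Qed.

Lemma closed_ideal_eq0 D e : positive_op D -> D e = 0 ->
  (forall x, closed_ideal e x) -> forall x, D x = 0.
Proof.
move=> D0 De he x; have [M M0 DM] := positive_bounded D0.
apply/eqP; rewrite -normr_le0; apply/ler_addgt0Pl => a a0; rewrite addr0.
have [c c0 xc] := he x _ (divr_gt0 a0 M0).
apply: le_trans (_ : `|D (ppart (labs x - c *: e))| <= _).
  apply: labs_le_norm; apply: le_trans (positive_labs _ D0) _.
  have -> : D (ppart (labs x - c *: e)) = D (ppart (labs x - c *: e) + c *: e).
    by rewrite [RHS]linearD [D (c *: e)]linearZZ De scaler0 addr0.
  by apply: positive_le => //; rewrite -rleBlDr ppart_ge.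
by apply: le_trans (DM _) _; rewrite mulrC -ler_pdivlMr.
Qed.

Lemma positive_eq0 Q : (forall x, 0 <= x -> Q x = 0) -> forall x, Q x = 0.
Proof.
by move=> Q0 x; rewrite -(ppartB x) linearB !Q0 ?ppart_ge0// subr0.
Qed.

(** The null ideal of the [y] with [Q |y| = 0] is closed and invariant under [T], and it is not the
    whole space as [Q] is not 0. *)
Lemma ideal_irreducible_strict T Q r : ideal_irreducible T -> 0 <= r ->
  positive_op Q -> (exists x, Q x != 0) -> (forall x, Q (T x) = r *: Q x) ->
  forall x, 0 <= x -> Q x = 0 -> x = 0.
Proof.
move=> [T0 irr] r0 Q0 [x1 Qx1] QT x x0 Qx0.
have [M M0 QM] := positive_bounded Q0.
pose N := [set y : X | Q (labs y) = 0].
have NP y w : 0 <= y -> y <= w -> Q w = 0 -> Q y = 0.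
  move=> y0 yw Qw; apply/eqP; rewrite eq_le Q0// andbT -Qw.
  exact: positive_le.
have oN : order_ideal N.
  split => [|y w Ny Nw|a y Ny|y w yw Nw]; rewrite /N /=.
  - by rewrite labs0 linear0.
  - apply: NP (labs_ge0 _) (labsD y w) _.
    by rewrite linearD Ny Nw addr0.
  - by rewrite labsZ linearZZ Ny scaler0.
  - exact: NP (labs_ge0 _) yw Nw.
have cN : closed N.
  move=> y cy; apply/eqP; rewrite -normr_le0; apply/ler_addgt0Pl => a a0.
  rewrite addr0; have [w [Nw]] := cy _ (nbhsx_ballx y _ (divr_gt0 a0 M0)).
  rewrite -ball_normE /= => yw.
  apply: le_trans (_ : `|Q (labs (y - w))| <= _).
    apply: norm_le; first by rewrite Q0 ?labs_ge0.
    rewrite -[leRHS]addr0 -Nw -linearD; apply: positive_le => //.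
    by rewrite -{1}(subrK w y) labsD.
  by apply: le_trans (QM _) _; rewrite norm_labs mulrC -ler_pdivlMr// ltW.
have iN : T @` N `<=` N.
  move=> _ [y Ny <-]; apply: NP (labs_ge0 _) (positive_labs _ T0) _.
  by rewrite QT Ny scaler0.
have [N0|NT] := irr _ oN cN iN.
  have : N x by rewrite /N /= labs_ge0_id.
  by rewrite N0.
have : N x1 by rewrite NT.
move=> Nx1; case/eqP: Qx1; apply: labs0_eq0; apply/eqP.
by rewrite eq_le labs_ge0 andbT -Nx1 positive_labs.
Qed.

(* The band {e}^dd generated by e. *)
Definition principal_band e : set X :=
  [set x | forall z, 0 <= z -> meet z e = 0 -> meet z (labs x) = 0].

Lemma principal_band_order_ideal e : order_ideal (principal_band e).
Proof.
split => [z z0 _|x y Bx By z z0 ze|a x Bx z z0 ze|x y xy By z z0 ze].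
- by rewrite labs0; apply: meet_r.
- apply: (meet_eq0_le z0 (labs_ge0 _) (labsD x y)).
  apply/eqP; rewrite eq_le meet_ge0 ?raddr_ge0 ?labs_ge0// andbT.
  apply: le_trans (meetDr_le _ _ _) _; rewrite ?labs_ge0//.
  by rewrite Bx// By// addr0.
- by rewrite labsZ meetZ_eq0 ?labs_ge0// Bx.
- by apply: (meet_eq0_le z0 (labs_ge0 _) xy); exact: By.
Qed.

Lemma join_disjoint x y z : meet x y = 0 -> x <= z -> y <= z -> x + y <= z.
Proof. by move=> xy0 xz yz; rewrite -join_meet xy0 addr0 leUx xz. Qed.

Lemma principal_band_band e : band (principal_band e).
Proof.
have [B0 BD BZ Bsolid] := principal_band_order_ideal e.
split; first exact: principal_band_order_ideal.
move=> D s DB [ub lub].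
have Bp : principal_band e (ppart s).
  move=> z z0 ze; rewrite labs_ge0_id ?ppart_ge0//.
  set w := meet z (ppart s).
  have w0 : 0 <= w by rewrite meet_ge0 ?ppart_ge0.
  have ws : w <= ppart s by exact: leIr.
  (* For [d] in [D], the vectors [ppart d] and [w] are disjoint and both below [ppart s], so their
     sum is too. Then [ppart s - w] is an upper bound of [D], which forces [w = 0]. *)
  have : s <= ppart s - w.
    apply: lub => d Dd; apply: le_trans (ppart_ge d) _.
    rewrite rleBrDr; apply: join_disjoint => //; last exact/ppart_le/ub.
    apply: (meet_eq0_le (ppart_ge0 _) w0 (leIl _ _)); rewrite meetC.
    by apply: (meet_eq0_le z0 (ppart_ge0 _) (ppart_labs d)); exact: DB.
  move=> /ppart_le; rewrite [ppart (_ - _)]ge0_ppart ?rsubr_ge0// rleBrDr.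
  rewrite -[X in _ <= X]addr0 ![ppart s + _]addrC rleD2r => w0'.
  by apply/eqP; rewrite eq_le w0' w0.
have Bn : principal_band e (ppart (- s)).
  have [[d Dd]|Dn] := pselect (exists d, D d).
    apply: (Bsolid _ d); last exact: DB.
    rewrite labs_ge0_id ?ppart_ge0// -labsN; apply: le_trans (ppart_labs _).
    by apply: ppart_le; rewrite rleN2; exact: ub.
  (* A supremum of the empty set is a least element of [X]; comparing [s] with [s + s] shows that it
     is nonnegative. *)
  have sle x : s <= x by apply: lub => d Dd; case: Dn; exists d.
  have s0 : 0 <= s by have := sle (s + s); rewrite rlerDl.
  suff -> : ppart (- s) = 0 by exact: B0.
  apply/eqP; rewrite eq_le ppart_ge0 andbT; apply: ppart_lub => //.
  by rewrite -oppr0 rleN2.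
apply: (Bsolid s (labs s)); first by rewrite labs_id.
by rewrite labsE; exact: BD.
Qed.

(** Let [w] be a lower bound of the differences and [v] the meet of its positive part with [e].
    Inductively [n v] is below the meet of [x] and [n e], so [v = 0] by the Archimedean property.
    Then [ppart w] is disjoint from [e], hence from [x], while [ppart w <= x]. *)
Lemma principal_band_order_cvg e x : 0 <= e -> 0 <= x -> principal_band e x ->
  order_cvg (fun n => x - meet x (n%:R *: e)) 0.
Proof.
move=> e0 x0 Bx; pose y n := x - meet x (n%:R *: e).
exists y; split => [n m nm||n].
- rewrite /y addrC [X in _ <= X]addrC rleD2r rleN2 meet_le2//.
  by rewrite rscale_ler// ler_nat.
- split => [_ [n _ <-]|w wy]; first by rewrite rsubr_ge0 leIl.
  have wyn n : ppart w <= y n by rewrite ppart_lub ?rsubr_ge0 ?leIl//; apply: wy; exists n.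
  set v := meet (ppart w) e.
  have v0 : 0 <= v by rewrite meet_ge0 ?ppart_ge0.
  have : v = 0.
    apply: (@archimedean _ _ x) => // n.
    elim: n => [|n IH]; first by rewrite mulr0n.
    rewrite mulrSr.
    have h : v *+ n <= meet x (n%:R *: e).
      by rewrite lexI IH/= -scaler_nat rscale_le// leIr.
    apply: le_trans (rle_add h (le_trans (leIl _ _) (wyn n))) _.
    by rewrite /y addrC subrK.
  move=> /(Bx _ (ppart_ge0 w)); rewrite labs_ge0_id// => wx.
  suff : ppart w = 0 by move=> w0; rewrite -w0 ppart_ge.
  rewrite -wx; apply/esym; apply: meet_l.
  have := wyn 0%N; rewrite /y scale0r [meet x 0]meet_r ?subr0//.
- by rewrite subr0 labs_ge0_id// rsubr_ge0 leIl.
Qed.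

Lemma weak_unit_band e : weak_unit e -> forall x, principal_band e x.
Proof.
by move=> we x z z0 /(we _ z0) ->; apply: meet_l; exact: labs_ge0.
Qed.

Lemma order_cvg_ge0_le (u : nat -> X) z : order_cvg u 0 -> (forall n, z <= u n) -> z <= 0.
Proof.
move=> [y [_ [_ glb] uy]] zu; apply: glb => _ [n _ <-].
apply: le_trans (zu n) _; apply: (le_trans _ (uy n)).
by rewrite subr0 labs_ge.
Qed.

Lemma sigma_order_continuous_le S T : positive_op S -> op_le S T ->
  sigma_order_continuous T -> sigma_order_continuous S.
Proof.
move=> S0 ST oT u [y [dy iy uy]].
have [|w [dw iw uw]] := oT (fun n => labs (u n)).
  by exists y; split => // n; rewrite subr0 labs_id; have := uy n; rewrite subr0.
exists w; split => // n; rewrite subr0 /=.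
apply: le_trans (positive_labs _ S0) _.
apply: le_trans (op_le_positive_le ST (labs_ge0 _)) _.
by apply: (le_trans _ (uw n)); rewrite subr0 labs_ge.
Qed.

(** Split [|x|] into its meet [p] with [n e] and the rest. The image of [p] is below a multiple of
    [e], hence disjoint from [z], and the image of the rest tends to 0 in order. An inequality
    [T e <= r e] is assumed because the lemma also serves for vectors [R(z, T) x], which are not
    eigenvectors. *)
Lemma principal_band_invariant T e r : positive_op T -> sigma_order_continuous T ->
  0 <= r -> 0 <= e -> T e <= r *: e ->
  T @` principal_band e `<=` principal_band e.
Proof.
move=> T0 oT r0 e0 Te _ [x Bx <-] z z0 ze.
have Bx' : principal_band e (labs x) by move=> w w0 we; rewrite labs_id; exact: Bx.
have cv := oT _ (principal_band_order_cvg e0 (labs_ge0 x) Bx').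
apply: (meet_eq0_le z0 (labs_ge0 _) (positive_labs _ T0)).
apply/eqP; rewrite eq_le meet_ge0 ?T0 ?labs_ge0// andbT.
apply: order_cvg_ge0_le cv _ => n /=.
set p := meet (labs x) _.
have p0 : 0 <= p by rewrite meet_ge0 ?labs_ge0// rscale_ge0.
have pe : T p <= (n%:R * r) *: e.
  apply: le_trans (positive_le T0 (leIr _ _)) _.
  by rewrite linearZZ -scalerA rscale_le.
have xp : 0 <= labs x - p by rewrite rsubr_ge0 leIl.
rewrite -{1}(subrK p (labs x)) linearD.
apply: le_trans (meetDr_le (T0 _ xp) (T0 _ p0) z0) _.
rewrite [X in _ + X](_ : _ = 0) ?addr0 ?leIr//.
apply: (meet_eq0_le z0 (T0 _ p0) pe).
by rewrite meetZ_eq0// mulr_ge0.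
Qed.

Lemma band_irreducible_weak_unit T e r : band_irreducible T ->
  sigma_order_continuous T -> 0 <= r -> 0 <= e -> e != 0 -> T e <= r *: e ->
  weak_unit e.
Proof.
move=> [T0 irr] oT r0 e0 en0 Te z z0 ze.
have [B0|BT] := irr _ (principal_band_band e)
    (principal_band_invariant T0 oT r0 e0 Te).
  have : principal_band e e by move=> w w0; rewrite labs_ge0_id.
  by rewrite B0 /= => /eqP; rewrite (negbTE en0).
have : principal_band e z by rewrite BT.
by move=> /(_ _ z0 ze); rewrite labs_ge0_id// meetxx.
Qed.

(** [D] vanishes on every meet of [x] with [n e], and these tend to [x] in order; the domination by
    [T] makes [D] sigma-order continuous. *)
Lemma weak_unit_eq0 D T e : positive_op D -> op_le D T -> sigma_order_continuous T ->
  0 <= e -> weak_unit e -> D e = 0 -> forall x, D x = 0.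
Proof.
move=> D0 DT oT e0 we De; apply: positive_eq0 => x x0.
have oD := sigma_order_continuous_le D0 DT oT.
have cv := oD _ (principal_band_order_cvg e0 x0 (weak_unit_band we x)).
apply/eqP; rewrite eq_le D0// andbT; apply: order_cvg_ge0_le cv _ => n /=.
rewrite linearB -[X in X <= _]subr0 [X in _ <= _ - X](_ : _ = 0)//.
apply/eqP; rewrite eq_le D0 ?meet_ge0 ?rscale_ge0// andbT.
by apply: le_trans (positive_le D0 (leIr _ _)) _; rewrite linearZZ De scaler0.
Qed.

End ideals_and_bands.

(** * The leading coefficient at a pole on the spectral radius *)

Section irreducible_poles.
Context {R : realType} {X : banachLatticeType R}.
Implicit Types (x y z e u w : X) (T S D Q B : {linear X -> X}) (a c t : R).

Local Notation meet := (@Order.meet ring_display X).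

Lemma cvg_positive (v : nat -> X) x : (forall n, 0 <= v n) -> v @ \oo --> x -> 0 <= x.
Proof.
move=> v0 /cvgrPdist_le vx; apply: le_approx => a a0.
have [n _ vn] := vx _ a0; exists (v n - x).
  by rewrite addrC subrK.
by rewrite distrC vn/=.
Qed.

Lemma pole_approx T r n Q : pole_coefficient T r n Q -> positive_op T ->
  r = spectral_radius T -> forall a, 0 < a ->
  exists t B, [/\ 0 < t < a, is_resolvent T (r + t) B, positive_op B
    & forall x, `|t ^+ n.+1 *: B x - Q x| <= a * `|x|].
Proof.
move=> [bQ nQ [M [d [d0 h]]]] T0 rT a a0.
pose t := Num.min (d / 2) (Num.min (a / 2) (a / (`|M| + 1))).
have M0 : 0 < `|M| + 1 by rewrite ltr_wpDl.
have t0 : 0 < t by rewrite !lt_min !divr_gt0.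
have td : t < d by rewrite gt_min; apply/orP; left; lra.
have ta : t < a by rewrite !gt_min; apply/orP; right; apply/orP; left; lra.
have tM : t <= a / (`|M| + 1) by rewrite !ge_min lexx !orbT.
have [|B rB B0] := @positive_resolvent _ _ T (r + t) T0; first by rewrite rT ltrDl.
exists t, B; split => // [|x]; first by rewrite t0.
apply: le_trans (h _ _ _ rB x) _; first by rewrite t0.
rewrite ler_wpM2r//; apply: le_trans (_ : (`|M| + 1) * t <= _).
  by rewrite ler_wpM2r ?(ltW t0)// (le_trans (ler_norm M))// lerDl.
by rewrite mulrC -ler_pdivlMr.
Qed.

Lemma pole_sequence T r n Q : pole_coefficient T r n Q -> positive_op T ->
  r = spectral_radius T ->
  exists (t : nat -> R) (B : nat -> {linear X -> X}),
  [/\ forall k, 0 < t k, t @ \oo --> 0,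
      forall k, is_resolvent T (r + t k) (B k), forall k, positive_op (B k)
    & forall x, (fun k => t k ^+ n.+1 *: B k x) @ \oo --> Q x].
Proof.
move=> pT T0 rT.
have hk k : exists tB : R * {linear X -> X}, [/\ 0 < tB.1 < k.+1%:R^-1,
    is_resolvent T (r + tB.1) tB.2, positive_op tB.2
  & forall x, `|tB.1 ^+ n.+1 *: tB.2 x - Q x| <= k.+1%:R^-1 * `|x|].
  have [|t [B h]] := pole_approx pT T0 rT (_ : 0 < k.+1%:R^-1); first by [].
  by exists (t, B).
have [tB h] := choice hk.
exists (fun k => (tB k).1), (fun k => (tB k).2); split.
- by move=> k; have [/andP[]] := h k.
- apply: (@squeeze_cvgr _ _ _ _ (fun=> 0) (fun k => k.+1%:R^-1) _); [|exact: cvg_cst|].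
    by near=> k; have [/andP[/ltW -> /ltW ->]] := h k.
  exact: cvg_harmonic.
- by move=> k; have [] := h k.
- by move=> k; have [] := h k.
move=> x; apply/subr_cvg0/norm_cvg0P.
apply: (@squeeze_cvgr _ _ _ _ (fun=> 0) (fun k => k.+1%:R^-1 * `|x|) _); [|exact: cvg_cst|].
  by near=> k; rewrite normr_ge0 /=; have [_ _ _] := h k; exact.
by rewrite -[X in _ --> X](mul0r `|x|); apply: cvgMr_tmp; exact: cvg_harmonic.
Unshelve. all: by end_near. Qed.

Section pole_coefficient_theory.
Variables (T Q : {linear X -> X}) (n : nat).
Local Notation r := (spectral_radius T).
Hypotheses (pT : pole_coefficient T r n Q) (T0 : positive_op T).

Let bT : bounded_op T := positive_bounded T0.

Lemma pole_coefficient_ge0 : positive_op Q.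
Proof.
have [t [B [t0 _ _ B0 cv]]] := pole_sequence pT T0 erefl.
move=> x x0; apply: cvg_positive (cv x) => k.
by rewrite rscale_ge0 ?B0// exprn_ge0// ltW.
Qed.

Lemma cvg_exp0 (t : nat -> R) m : t @ \oo --> (0 : R) ->
  (fun k => t k ^+ m.+1) @ \oo --> (0 : R).
Proof.
move=> tc; rewrite (_ : 0 = 0 ^+ m.+1 :> R); last by rewrite expr0n.
exact: cvg_comp tc (@exprn_continuous _ m.+1 0).
Qed.

Lemma pole_coefficient_comm x : Q (T x) = r *: Q x /\ T (Q x) = r *: Q x.
Proof.
have [t [B [t0 tc rB B0 cv]]] := pole_sequence pT T0 erefl.
have lim : (fun k => (r + t k) *: (t k ^+ n.+1 *: B k x) - t k ^+ n.+1 *: x) @ \oo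
    --> r *: Q x.
  rewrite -[X in _ --> X](subr0 (r *: Q x)); apply: cvgB.
    apply: cvgZ; last exact: cv.
    by rewrite -[X in _ --> X](addr0 r); apply: cvgD => //; exact: cvg_cst.
  rewrite -[X in _ --> X](scale0r x); apply: cvgZr_tmp; exact: cvg_exp0.
split.
  apply: norm_cvg_unique lim; rewrite (_ : (fun k => _) = (fun k => t k ^+ n.+1 *: B k (T x))).
    exact: cv.
  apply/funext => k; have [_ BL _] := rB k.
  rewrite scalerA mulrC -scalerA -scalerBr; congr (_ *: _).
  by rewrite -{2}(BL x) linearB linearZZ opprB addrC subrK.
apply: norm_cvg_unique (bounded_op_cvg bT (cv x)) _.
rewrite (_ : T \o _ = fun k => (r + t k) *: (t k ^+ n.+1 *: B k x) - t k ^+ n.+1 *: x)//.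
apply/funext => k /=; have [_ _ LB] := rB k.
rewrite linearZZ scalerA mulrC -scalerA -scalerBr; congr (_ *: _).
by rewrite -{3}(LB x) opprB addrC subrK.
Qed.

(** As [Q T = r Q], applying [Q] to [t^(n+1) R(r + t, T) x] gives [t^n Q x], so [Q Q] is the limit
    of [t^n Q]. *)
Lemma pole_coefficient_idem : (0 < n)%N /\ (forall x, Q (Q x) = 0) \/
  n = 0%N /\ forall x, Q (Q x) = Q x.
Proof.
have [t [B [t0 tc rB B0 cv]]] := pole_sequence pT T0 erefl.
have [bQ _ _] := pT.
have E x k : Q (t k ^+ n.+1 *: B k x) = t k ^+ n *: Q x.
  have [_ _ LB] := rB k.
  rewrite linearZZ -{2}(LB x) linearB (pole_coefficient_comm _).1 linearZZ -scalerBl.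
  by rewrite addrC addKr scalerA -exprSr.
have lim x : (fun k => t k ^+ n *: Q x) @ \oo --> Q (Q x).
  by under eq_fun do rewrite -E; exact: (bounded_op_cvg bQ (cv x)).
case: (n) lim => [|m] lim; [right|left]; split => // x.
  apply: norm_cvg_unique (lim x) _.
  rewrite (_ : (fun k => _) = fun=> Q x); first exact: cvg_cst.
  by apply/funext => k; rewrite expr0 scale1r.
apply: norm_cvg_unique (lim x) _.
have : (fun k => t k ^+ m.+1 *: Q x) @ \oo --> 0 *: Q x.
  by apply: cvgZr_tmp; exact: cvg_exp0.
by rewrite scale0r.
Qed.

(** The computation for [Q Q], with a fixed functional in place of the outer [Q]. In the band case
    it transfers the strict positivity of [f] to [Q]. *)
Lemma pole_functional (f : {scalar X}) : continuous f ->
  (forall x, f (T x) = r * f x) ->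
  (0 < n)%N /\ (forall x, f (Q x) = 0) \/ n = 0%N /\ forall x, f (Q x) = f x.
Proof.
move=> cf fT.
have [t [B [t0 tc rB B0 cv]]] := pole_sequence pT T0 erefl.
have E x k : f (t k ^+ n.+1 *: B k x) = t k ^+ n * f x.
  have [_ _ LB] := rB k.
  rewrite linearZ /= -{2}(LB x) linearB linearZ /= fT -mulrBl.
  by rewrite addrC addKr mulrA -exprSr.
have lim x : (fun k => t k ^+ n * f x) @ \oo --> f (Q x).
  by under eq_fun do rewrite -E; exact: cvg_comp (cv x) (cf (Q x)).
case: (n) lim => [|m] lim; [right|left]; split => // x.
  apply: norm_cvg_unique (lim x) _.
  rewrite (_ : (fun k => _) = fun=> f x); first exact: cvg_cst.
  by apply/funext => k; rewrite expr0 mul1r.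
apply: norm_cvg_unique (lim x) _.
have : (fun k => t k ^+ m.+1 * f x) @ \oo --> 0 * f x.
  by apply: cvgMr_tmp; exact: cvg_exp0.
by rewrite mul0r.
Qed.

(** This property and the next one stand in for irreducibility, so that the ideal and the band case
    share what follows. *)
Hypothesis strict : forall x, 0 <= x -> Q x = 0 -> x = 0.
Hypothesis unit : forall e, 0 <= e -> e != 0 -> T e = r *: e -> weak_unit e.

Let Q0 := pole_coefficient_ge0.

(** [T |u| - r |u|] is nonnegative and killed by [Q], hence 0. So [ppart u] is an eigenvector too;
    if it is not 0 it is a weak unit, and the negative part of [u], disjoint from it, vanishes. *)
Lemma fixed_sign u : T u = r *: u -> 0 <= u \/ u <= 0.
Proof.
move=> Tu; have r0 := spectral_radius_ge0 bT.
have Tau : T (labs u) = r *: labs u.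
  apply/eqP; rewrite -subr_eq0; apply/eqP; apply: strict.
    by rewrite rsubr_ge0; have := positive_labs u T0; rewrite Tu labsZ ger0_norm.
  by rewrite linearB linearZZ (pole_coefficient_comm _).1 subrr.
have pE : ppart u = 2^-1 *: (labs u + u).
  rewrite labsE -{4}(ppartB u) addrACA subrr addr0 -mulr2n -[ppart u *+ 2]scaler_nat scalerA.
  by rewrite mulVf ?scale1r.
have Tp : T (ppart u) = r *: ppart u.
  by rewrite pE linearZZ linearD Tau Tu -scalerDr !scalerA mulrC.
have [p0|pn0] := eqVneq (ppart u) 0; first by right; rewrite -p0 ppart_ge.
left; have := unit (ppart_ge0 u) pn0 Tp (ppart_ge0 (- u)).
rewrite meetC meet_ppart => /(_ erefl) n0.
by rewrite -(ppartB u) n0 subr0 ppart_ge0.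
Qed.

(** By [fixed_sign], each [u - a e] is comparable with 0. The supremum of the [a] with [a e <= u] is
    therefore a cut, at which both inequalities hold by closedness of the cone. *)
Lemma fixed_line e u : 0 <= e -> e != 0 -> T e = r *: e -> T u = r *: u ->
  exists a, u = a *: e.
Proof.
move=> e0 en0 Te Tu.
have ne : 0 < `|e| by rewrite normr_gt0.
have dic a : a *: e <= u \/ u <= a *: e.
  have [|h|h] := @fixed_sign (u - a *: e); first by rewrite linearB linearZZ Te Tu scalerBr !scalerA mulrC.
    by left; rewrite -rsubr_ge0.
  by right; have := h; rewrite rleBlDr add0r.
have bnd a w : a *: e <= w -> a <= `|w| / `|e|.
  move=> ae; have [a0|a0] := leP a 0; first by rewrite (le_trans a0)// divr_ge0.
  rewrite ler_pdivlMr// -[X in X * _](gtr0_norm a0) -normrZ norm_le// rscale_ge0// ltW//.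
pose A := [set a : R | a *: e <= u].
have hA : has_sup A.
  split; last by exists (`|u| / `|e|) => a; exact: bnd.
  pose c := `|u| / `|e| + 1.
  exists (- c); have [//|h] := dic (- c).
  have : c *: e <= - u by rewrite -rleN2 opprK -scaleNr.
  by move=> /bnd; rewrite normrN /c gerDl leNgt ltr01.
exists (sup A); apply/eqP; rewrite eq_le; apply/andP; split; apply: le_approx => a a0.
  exists ((a / `|e|) *: e); last by rewrite normrZ ger0_norm ?divfK ?gt_eqF// divr_ge0// ltW.
  rewrite -scalerDl; have [h|//] := dic (sup A + a / `|e|).
  have := ub_le_sup hA.2 h; rewrite gerDl leNgt divr_gt0//.
exists ((a / `|e|) *: e); last by rewrite normrZ ger0_norm ?divfK ?gt_eqF// divr_ge0// ltW.
have [b Ab ab] := sup_adherent (divr_gt0 a0 ne) hA.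
rewrite -rleBlDr -scalerBl; apply: le_trans (_ : b *: e <= _) => //.
by rewrite rscale_ler// ltW.
Qed.

Lemma pole_rank1 : n = 0%N /\ exists e (f : {scalar X}),
  [/\ 0 <= e /\ e != 0, T e = r *: e, f e = 1,
      (forall x, Q x = f x *: e) /\ (forall x, f (T x) = r * f x)
    & [/\ forall x, 0 <= x -> 0 <= f x, forall x, 0 <= x -> f x = 0 -> x = 0
        & exists2 F, 0 < F & forall x, `|f x| <= F * `|x|]].
Proof.
have [bQ [x1 Qx1] _] := pT.
(* A multiple pole would give [Q (Q x) = 0], and strictness applied twice would annihilate [Q]. *)
have [[_ QQ]|[n0 QQ]] := pole_coefficient_idem.
  case/eqP: Qx1; apply: positive_eq0 => x x0.
  exact: strict (Q0 x0) (QQ x).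
split => //.
have [e [e0 en0 Te Qe]] : exists e, [/\ 0 <= e, e != 0, T e = r *: e & Q e = e].
  have [x [x0 Qx]] : exists x, 0 <= x /\ Q x != 0.
    apply: contrapT => h; case/eqP: Qx1; apply: positive_eq0 => x x0.
    by apply: contrapT => /eqP Qx; apply: h; exists x.
  exists (Q x); split => //; first exact: Q0.
  exact: (pole_coefficient_comm x).2.
have ne : 0 < `|e| by rewrite normr_gt0.
have hf x : exists a, Q x = a *: e.
  by apply: fixed_line => //; exact: (pole_coefficient_comm x).2.
have [f fE] := choice hf.
have inj a b : a *: e = b *: e -> a = b.
  move=> /eqP; rewrite -subr_eq0 -scalerBl scaler_eq0 (negbTE en0) orbF subr_eq0.
  by move=> /eqP.
have flin : scalar f.
  move=> a x y; apply: inj.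
  by rewrite -fE linearP !fE scalerDl scalerA.
pose g : {scalar X} := HB.pack f (GRing.isLinear.Build _ _ _ _ _ flin).
have f0 x : 0 <= x -> 0 <= f x.
  move=> x0; rewrite leNgt; apply/negP => fx.
  have := Q0 x0; rewrite fE -rleN2 oppr0 -scaleNr => h.
  have : e <= 0 by rewrite -[e]scale1r -(@rle_pZl _ _ (- f x)) ?oppr_gt0// scaler0 scale1r.
  by move=> e0'; case/eqP: en0; apply/eqP; rewrite eq_le e0' e0.
exists e, g; split => //=.
- by apply: inj; rewrite -fE Qe scale1r.
- split => // x; apply: inj.
  by rewrite -fE (pole_coefficient_comm x).1 fE scalerA.
split => //.
  by move=> x x0 fx; apply: strict => //; rewrite fE fx scale0r.
have [M M0 QM] := bQ; exists (M / `|e|); first exact: divr_gt0.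
by move=> x; rewrite mulrAC ler_pdivlMr// -normrZ -fE.
Qed.

End pole_coefficient_theory.

End irreducible_poles.

(** * Comparison *)

Section comparison.
Context {R : realType} {X : banachLatticeType R}.
Variables (S T Q : {linear X -> X}) (e : X) (f : {scalar X}) (F : R).
Hypotheses (S0 : positive_op S) (ST : op_le S T).
Hypotheses (rST : spectral_radius T = spectral_radius S).
Hypotheses (e0 : 0 <= e) (en0 : e != 0) (QE : forall x, Q x = f x *: e).
Hypotheses (f0 : forall x, 0 <= x -> 0 <= f x) (F0 : 0 < F).
Hypotheses (fF : forall x, `|f x| <= F * `|x|).
Implicit Types (x u v w : X).

Let D : {linear X -> X} := T \- S.

Let DE x : D x = T x - S x. Proof. by []. Qed.

Let D0 : positive_op D. Proof. exact: ST. Qed.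

Let T0 : positive_op T.
Proof. by move=> x x0; apply: le_trans (S0 x0) (op_le_positive_le ST x0). Qed.

Let f_le x y : x <= y -> f x <= f y.
Proof. by move=> xy; rewrite -subr_ge0 -linearB f0// rsubr_ge0. Qed.

Let ne : 0 < `|e|. Proof. by rewrite normr_gt0. Qed.

Let f_norm x : f x <= F * `|x|.
Proof. exact: le_trans (ler_norm _) (fF x). Qed.

(* An approximate eigenvector u of S is, up to a small error, dominated by the
   residue f u *: e of R(., T) at u, hence close to it for the seminorm x |-> f |x|;
   as f (D u) is small, so is f (D e). *)
Lemma residue_dominating_eq0 : 0 < spectral_radius S -> f e = 1 ->
  pole_coefficient T (spectral_radius T) 0 Q ->
  (forall x, f (T x) = spectral_radius T * f x) -> f (T e - S e) = 0.
Proof.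
move=> rS fe pT fT; set r := spectral_radius T in pT fT.
have r0 : 0 < r by rewrite /r rST.
apply/eqP; rewrite eq_le f0 ?D0// andbT leNgt; apply/negP.
(* The estimates below end in [(1 - 2 a) al <= a K]. With [a <= 1/4] and [4 a K <= al] this reads
   [al / 2 <= al / 4], which is absurd. *)
rewrite -DE; set al := f (D e) => al0.
pose K := `|e| * (F * (1 + 4 * r)).
have K0 : 0 < K by rewrite !mulr_gt0// addr_gt0// ?mulr_gt0.
pose a := Num.min (4^-1) (al / (4 * K)).
have K4 : 0 < 4 * K by exact: mulr_gt0.
have a0 : 0 < a by rewrite lt_min invr_gt0 ltr0n divr_gt0.
have a4 : a <= 4^-1 by rewrite ge_min lexx.
have aK : a * (4 * K) <= al by rewrite -ler_pdivlMr// ge_min lexx orbT.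
have [t [B [/andP[t0 ta] [[b b0 Bb] BL LB] B0 tB]]] := pole_approx pT T0 erefl a0.
(* The accuracy of the eigenvector depends on the norm bound [b] of the resolvent at [r + t], so [u]
   is chosen after [t]: both [h] and [B h] have to be small. *)
have c0 : 0 < Num.min a (a / b) by rewrite lt_min a0 divr_gt0.
have [u [u0 u1]] := approx_eigenvector S0 rS c0.
rewrite -rST -/r; set h := S u - r *: u => hle.
have ha : `|h| <= a by apply: le_trans hle _; rewrite ge_min lexx.
have hb : b * `|h| <= a.
  by rewrite mulrC -ler_pdivlMr//; apply: le_trans hle _; rewrite ge_min lexx orbT.
have Tu : T u - r *: u = D u + h by rewrite DE /h addrA subrK.
(* Since [t u = ((r + t) u - T u) + (D u + h)], applying [B] gives the formula. Dropping the
   nonnegative [B (D u)] is what makes [t B u], and so [f u *: e], an approximate upper bound of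
   [u]. *)
have tBu : t *: B u = u + B (D u) + B h.
  rewrite -addrA -linearD -Tu -{2}(BL u) -linearZZ -linearD; congr (B _).
  by rewrite scalerDl addrA subrK addrAC subrr add0r.
set d := (t *: B u - f u *: e) - B h.
have ud : u - f u *: e <= d.
  have -> : d = u - f u *: e + B (D u).
    by rewrite /d tBu addrAC addrK addrAC.
  by rewrite rlerDl B0// D0.
have nd : `|d| <= 2 * a.
  apply: le_trans (ler_normB _ _) _; rewrite mulr2n mulrDl mul1r; apply: lerD.
    by have := tB u; rewrite u1 mulr1 QE expr1.
  exact: le_trans (Bb _) hb.
set v := u - f u *: e in ud.
(* As [f v = 0], the two parts of [v] have the same value under [f], so the one-sided bound [v <= d]
   controls [f |v|]. *)
have fv : f v = 0 by rewrite /v linearB linearZ /= fe mulr1 subrr.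
have fvp : f (ppart v) <= F * (2 * a).
  apply: le_trans (f_le (ppart_le ud)) _; apply: le_trans (f_norm _) _.
  by rewrite ler_wpM2l ?(ltW F0)// (le_trans (norm_ppart _)).
have fvn : f (ppart (- v)) = f (ppart v).
  by move: fv; rewrite -{1}(ppartB v) linearB => /eqP; rewrite subr_eq0 => /eqP.
have fav : f (labs v) <= F * (4 * a).
  by rewrite labsE linearD fvn; move: fvp; lra.
have fu : 1 - 2 * a <= f u * `|e|.
  have : `|u| <= `|f u *: e + d|.
    by rewrite norm_le// addrC -rleBlDr.
  move=> /le_trans/(_ (ler_normD _ _)); rewrite u1 normrZ ger0_norm ?f0//.
  by move: nd; lra.
have fDu : f (D u) <= F * a.
  have : f (D u + h) = 0 by rewrite -Tu linearB linearZ /= fT subrr.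
  rewrite linearD => /eqP; rewrite addr_eq0 => /eqP ->.
  apply: le_trans (ler_norm _) _; rewrite normrN; apply: le_trans (fF _) _.
  by rewrite ler_wpM2l ?(ltW F0).
have fDv : - f (D v) <= r * (F * (4 * a)).
  apply: le_trans (_ : f (D (labs v)) <= _).
    by rewrite -linearN -linearN f_le// positive_le// labs_geN.
  apply: le_trans (_ : f (T (labs v)) <= _).
    by apply: f_le; rewrite DE rlerBl S0 ?labs_ge0.
  by rewrite fT ler_wpM2l ?(ltW r0).
have fual : f u * al = f (D u) - f (D v).
  by rewrite -linearB -linearB /v opprB addrCA subrr addr0 !linearZ.
have h1 : (1 - 2 * a) * al <= a * K.
  apply: le_trans (ler_wpM2r (ltW al0) fu) _.
  rewrite mulrAC fual mulrC /K mulrCA ler_wpM2l ?(ltW ne)//.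
  have -> : a * (F * (1 + 4 * r)) = F * a + r * (F * (4 * a)) by ring.
  exact: lerD.
have : 2^-1 * al <= (1 - 2 * a) * al by rewrite ler_wpM2r ?(ltW al0)//; lra.
move: h1 aK al0; have -> : a * (4 * K) = 4 * (a * K) by ring.
lra.
Qed.

(* If f (D e) > 0, the operator D R(z, S) expands a cone around D e as z decreases
   to r, and the Neumann series of R(z, T) at D e is unbounded. *)
Lemma residue_dominated_eq0 : f e = 1 ->
  pole_coefficient S (spectral_radius S) 0 Q ->
  (forall x, f (S x) = spectral_radius S * f x) -> f (T e - S e) = 0.
Proof.
move=> fe pS fS; set r := spectral_radius S in pS fS.
apply/eqP; rewrite eq_le f0 ?D0// andbT leNgt; apply/negP.
rewrite -DE; set d := D e; set al := f d => al0.
have d0 : 0 <= d by exact: D0.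
have nd : 0 < `|d|.
  by rewrite normr_gt0; apply/eqP => d'0; move: al0; rewrite /al d'0 linear0 ltxx.
(* The cone is that of the [x >= 0] with [c |x| <= f x]. It contains [d], with room to spare,
   because [c |d| = al / 4] and [f d = al]. *)
pose c := al / (4 * `|d|).
have c0 : 0 < c by rewrite divr_gt0// mulr_gt0.
have cd : c * `|d| = al / 4 by rewrite /c; field; rewrite gt_eqF.
have [M M0 DM] := positive_bounded D0.
(* [p] bounds the distance in operator norm from [t K] to the rank-one operator [f(.) d]. One bound
   on [p] keeps [f (K x)] large, the other keeps [c |K x|] below it. *)
pose p := Num.min (al / 4) (al / 2 * c / F).
have al2 : 0 < al / 2 by exact: divr_gt0.
have p0 : 0 < p by rewrite lt_min !divr_gt0//; exact: mulr_gt0.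
have p4 : p <= al / 4 by rewrite ge_min lexx.
have pF : F * p <= al / 2 * c by rewrite mulrC -ler_pdivlMr// ge_min lexx orbT.
pose a := Num.min (al / 2) (p / M).
have a0 : 0 < a by rewrite lt_min !divr_gt0.
have aM : M * a <= p by rewrite mulrC -ler_pdivlMr// ge_min lexx orbT.
have [t [B [/andP[t0 ta] [bB BL LB] B0 tB]]] := pole_approx pS S0 erefl a0.
have tal : t <= al / 2 by rewrite (le_trans (ltW ta))// ge_min lexx.
have [C [bC CL LC] C0] : exists2 C, is_resolvent T (r + t) C & positive_op C.
  by apply: positive_resolvent => //; rewrite rST ltrDl.
pose K : {linear X -> X} := D \o B.
have K0 : positive_op K by move=> x x0; rewrite /= D0// B0.
have tK x : `|t *: K x - f x *: d| <= p * `|x|.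
  have -> : t *: K x - f x *: d = D (t *: B x - f x *: e).
    by rewrite [RHS]linearB !linearZZ.
  apply: le_trans (DM _) _.
  have := tB x; rewrite expr1 QE => h; apply: le_trans (ler_wpM2l (ltW M0) h) _.
  by rewrite mulrA ler_wpM2r.
(* On the cone, [t f (K x) >= al f x - F p |x| >= (al / 2) f x], which dominates both [t f x], as
   [t <= al / 2], and [t c |K x|]. *)
have cone x : 0 <= x -> c * `|x| <= f x -> f x <= f (K x) /\ c * `|K x| <= f (K x).
  move=> x0 cx; have fx := f0 x0.
  have pcx : p * `|x| * c <= p * f x by rewrite -mulrA [_ * c]mulrC ler_wpM2l// ltW.
  have h1 : al / 2 * f x <= t * f (K x).
    have : f (f x *: d - t *: K x) <= F * (p * `|x|).
      by apply: le_trans (f_norm _) _; rewrite ler_wpM2l ?(ltW F0)// distrC.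
    have -> : f (f x *: d - t *: K x) = f x * al - t * f (K x).
      by rewrite linearB !linearZ.
    move=> h.
    have : F * (p * `|x|) <= al / 2 * f x.
      rewrite mulrA; apply: le_trans (ler_wpM2r (normr_ge0 x) pF) _.
      by rewrite -(mulrA (al / 2)) ler_wpM2l// ltW.
    by move: h; set y := f (K x); lra.
  have h2 : t * (c * `|K x|) <= al / 2 * f x.
    have : `|t *: K x| <= f x * `|d| + p * `|x|.
      rewrite -[X in `|X|](subrK (f x *: d)) addrC; apply: le_trans (ler_normD _ _) _.
      by rewrite normrZ ger0_norm// lerD.
    rewrite normrZ gtr0_norm// => /(ler_wpM2l (ltW c0)).
    have -> : c * (f x * `|d| + p * `|x|) = f x * (c * `|d|) + p * `|x| * c by ring.
    rewrite cd => h; rewrite mulrCA; apply: le_trans h _.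
    have : p * f x <= al / 4 * f x by rewrite ler_wpM2r.
    by move: pcx; lra.
  split; rewrite -(ler_pM2l t0); last exact: le_trans h2 h1.
  by apply: le_trans h1; rewrite ler_wpM2r.
have Kd k : [/\ 0 <= iter k K d, al <= f (iter k K d)
              & c * `|iter k K d| <= f (iter k K d)].
  elim: k => [|k [i0 ial ic]] /=; first by split => //; rewrite cd -/al; lra.
  have [k1 k2] := cone _ i0 ic; split => //; first exact: K0.
  exact: le_trans ial k1.
pose g := C d; have g0 : 0 <= g by exact: C0.
(* From [(r + t) g - S g = d + D g = h] follows [g = B h], so [h] solves [h = d + K h]. Its
   existence rests on [r + t] exceeding the spectral radius of [T]; being nonnegative, it dominates
   every partial sum of the [K^k d], on each of which [f] is at least [al]. *)
pose h := d + D g.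
have hK : h = d + K h.
  rewrite {1}/h /=; congr (_ + D _); rewrite -{1}(BL g); congr (B _).
  have := LC d; rewrite -/g /h DE => /eqP; rewrite subr_eq => /eqP ->.
  by rewrite -addrA.
have iterK m : iter m K h = iter m K d + iter m.+1 K h.
  by elim: m => [|m IH]; [exact: hK | rewrite iterS {1}IH linearD].
have hN N : h = \sum_(k < N) iter k K d + iter N K h.
  elim: N => [|N IH]; first by rewrite big_ord0 add0r.
  by rewrite big_ord_recr {1}IH iterK addrA.
have h0 : 0 <= h by rewrite raddr_ge0// D0.
have fh N : N%:R * al <= f h.
  rewrite (hN N) linearD linear_sum -[X in X <= _]addr0; apply: lerD; last first.
    by apply: f0; elim: (N) => //= m IHm; exact: K0.
  rewrite mulr_natl -[N in _ *+ N]card_ord -sumr_const; apply: ler_sum => k _.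
  by have [] := Kd k.
have := fh (Num.bound (f h / al)); rewrite leNgt => /negP; apply.
by rewrite -ltr_pdivrMr// archi_boundP// divr_ge0 ?f0// ltW.
Qed.

End comparison.

(** * Irreducible operators with a pole at the spectral radius *)

Section irreducible_operators.
Context {R : realType} {X : banachLatticeType R}.
Implicit Types (x y z e : X) (S T D Q : {linear X -> X}).

(* For 0 < x with f x = 0, the resolvent of T sends x to a weak unit on which f
   vanishes; by sigma-order continuity f vanishes identically. *)
Lemma band_irreducible_functional_strict T (f : {scalar X}) :
  band_irreducible T -> sigma_order_continuous T ->
  functional_sigma_order_continuous f -> functional_gt0 f ->
  (forall x, f (T x) = spectral_radius T * f x) ->
  forall x, 0 <= x -> f x = 0 -> x = 0.
Proof.
move=> bT oT ocf [f0 [x1 fx1]] fT x x0 fx.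
have T0 : positive_op T by case: bT.
have r0 := spectral_radius_ge0 (positive_bounded T0).
set r := spectral_radius T in fT r0.
(* With the shift 1, the relation [f T = r f] gives [f (B x) = f x = 0], while
   [T (B x) <= (r + 1) B x] makes [B x] a weak unit. *)
have [|B [_ _ LB] B0] := @positive_resolvent _ _ T (r + 1) T0; first by rewrite ltrDl.
apply: contrapT => /eqP xn0; case/eqP: fx1.
have y0 := B0 _ x0.
have Ty : T (B x) <= (r + 1) *: B x by rewrite -rsubr_ge0 LB.
have yn0 : B x != 0.
  by apply: contra_neq xn0 => Bx0; rewrite -(LB x) Bx0 !linear0 addr0.
have fy : f (B x) = 0.
  rewrite -fx -[in RHS](LB x) linearB linearZ /= fT -mulrBl.
  by rewrite addrC addKr mul1r.
have we := band_irreducible_weak_unit bT oT (addr_ge0 r0 ler01) y0 yn0 Ty.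
have fpos z : 0 <= z -> f z = 0.
  move=> z0; have cv := ocf _ (principal_band_order_cvg y0 z0 (weak_unit_band we z)).
  apply: (norm_cvg_unique _ cv).
  rewrite (_ : f \o _ = fun=> f z); first exact: cvg_cst.
  apply/funext => n /=; rewrite linearB.
  set m := Order.meet _ _.
  have m0 : 0 <= m by rewrite meet_ge0// rscale_ge0.
  suff -> : f m = 0 by rewrite subr0.
  apply/eqP; rewrite eq_le f0// andbT.
  have := f0 (n%:R *: B x - m); rewrite rsubr_ge0 leIr => /(_ isT).
  by rewrite linearB linearZ /= fy mulr0 sub0r oppr_ge0.
by rewrite -(ppartB x1) linearB !fpos ?ppart_ge0// subr0.
Qed.

(** One statement for both halves of the theorem: the irreducible operator with the pole is [S]
    here, and the first half uses the pair formed by [T] twice. The last clause concerns operators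
    below the larger [T], since the difference to be annihilated is bounded by [T] and not by
    [S]. *)
Lemma irreducible_pole_rank1 S T : positive_op S -> op_le S T ->
  is_pole_of_resolvent S (spectral_radius S) ->
  ideal_irreducible S \/
  [/\ band_irreducible S, sigma_order_continuous T
    & exists f : {scalar X},
        [/\ continuous f, functional_sigma_order_continuous f, functional_gt0 f
          & adjoint S f =1 (fun x => spectral_radius S * f x)]] ->
  exists Q e (f : {scalar X}) (F : R),
  [/\ pole_coefficient S (spectral_radius S) 0 Q,
      [/\ 0 <= e, e != 0, S e = spectral_radius S *: e & f e = 1],
      (forall x, Q x = f x *: e) /\ (forall x, f (S x) = spectral_radius S * f x),
      [/\ forall x, 0 <= x -> 0 <= f x, forall x, 0 <= x -> f x = 0 -> x = 0,
          0 < F & forall x, `|f x| <= F * `|x|]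
    & forall D, positive_op D -> op_le D T -> D e = 0 -> forall x, D x = 0].
Proof.
move=> S0 ST /pole_coefficient_exists [n [Q pQ]] irr.
set r := spectral_radius S in pQ irr *.
have bS := positive_bounded S0.
have r0 : 0 <= r := spectral_radius_ge0 bS.
have Q0 := pole_coefficient_ge0 pQ S0.
have QS x := (pole_coefficient_comm pQ S0 x).1.
have [_ nQ _] := pQ.
have strict x : 0 <= x -> Q x = 0 -> x = 0.
  case: irr => [irr|[bS' oT [f [cf ocf fp fS]]]].
    exact: (ideal_irreducible_strict irr r0 Q0 nQ QS).
  have fs := band_irreducible_functional_strict bS'
    (sigma_order_continuous_le S0 ST oT) ocf fp fS.
  move=> x0 Qx; have [[_ fQ]|[_ fQ]] := pole_functional pQ S0 cf fS.
    have [y /eqP[]] := nQ; apply: positive_eq0 => z z0.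
    exact: fs (Q0 _ z0) (fQ z).
  by apply: fs => //; rewrite -fQ Qx linear0.
have unit e : 0 <= e -> e != 0 -> S e = r *: e ->
    weak_unit e /\ forall D, positive_op D -> op_le D T -> D e = 0 -> forall x, D x = 0.
  move=> e0 en0 Se; case: irr => [irr|[bS' oT _]].
    have tot := ideal_irreducible_total irr bS r0 e0 en0 Se.
    split; first exact: closed_ideal_weak_unit.
    by move=> D D0 _ De; exact: closed_ideal_eq0 D0 De tot.
  have we : weak_unit e.
    apply: (band_irreducible_weak_unit bS' _ r0 e0 en0); last by rewrite Se.
    exact: sigma_order_continuous_le oT.
  by split => // D D0 DT De; exact: weak_unit_eq0 D0 DT oT e0 we De.
have [n0 [e [f [[e0 en0] Se fe [QE fS] [f0 fs [F F0 fF]]]]]] :=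
  pole_rank1 pQ S0 strict (fun e h1 h2 h3 => (unit e h1 h2 h3).1).
rewrite n0 in pQ; exists Q, e, f, F; split => //.
exact: (unit e e0 en0 Se).2.
Qed.

End irreducible_operators.

Theorem theorem3p9 (R : realType) (X : banachLatticeType R)
  (hX : dim_gt1 X) (S T : {linear X -> X})
  (hT0 : exists x, T x != 0) (hS : positive_op S) (hST : op_le S T)
  (hr : spectral_radius T = spectral_radius S) :
  (is_pole_of_resolvent T (spectral_radius T) ->
     ideal_irreducible T \/
     [/\ band_irreducible T,
         sigma_order_continuous T
       & exists f : {scalar X},
           [/\ continuous f, functional_sigma_order_continuous f,
               functional_gt0 f
             & adjoint T f =1 (fun x => spectral_radius T * f x)]] ->
     T =1 S)
  /\
  (is_pole_of_resolvent S (spectral_radius S) ->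
     ideal_irreducible S \/
     [/\ band_irreducible S,
         exists f : {scalar X},
           [/\ continuous f, functional_sigma_order_continuous f,
               functional_gt0 f
             & adjoint S f =1 (fun x => spectral_radius S * f x)]
       & sigma_order_continuous T] ->
     T =1 S).
Proof.
have T0 : positive_op T.
  by move=> x x0; apply: le_trans (hS _ x0) (op_le_positive_le hST x0).
pose D : {linear X -> X} := T \- S.
have DT : op_le D T by move=> x x0; rewrite /= opprB addrC subrK hS.
have conclude e (f : {scalar X}) : 0 <= e ->
    (forall x, 0 <= x -> f x = 0 -> x = 0) ->
    (forall D : {linear X -> X}, positive_op D -> op_le D T -> D e = 0 ->
      forall x, D x = 0) ->
    f (T e - S e) = 0 -> T =1 S.
  move=> e0 fs kill fD x; apply/eqP; rewrite -subr_eq0; apply/eqP.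
  by apply: (kill D) => //; apply: fs fD; exact: hST.
split => pole irr.
  have TT : op_le T T by move=> x _; rewrite /= subrr.
  have [Q [e [f [F [pQ [e0 en0 Te fe] [QE fT] [f0 fs F0 fF] kill]]]]] :=
    irreducible_pole_rank1 T0 TT pole irr.
  apply: (conclude e f) => //.
  have r0 := spectral_radius_ge0 (positive_bounded T0).
  (* Approximate eigenvectors are available for a positive spectral radius only. If it is 0, then
     [T e = 0] and [T] itself is annihilated, against [hT0]. *)
  have [rS0|rSn0] := eqVneq (spectral_radius S) 0.
    have [x] := hT0; rewrite (kill T) ?eqxx//.
    by rewrite Te hr rS0 scale0r.
  apply: (@residue_dominating_eq0 _ _ S T Q e f F) => //.
  by rewrite lt_def rSn0 -hr.
have {}irr : ideal_irreducible S \/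
    [/\ band_irreducible S, sigma_order_continuous T
      & exists f : {scalar X}, [/\ continuous f, functional_sigma_order_continuous f,
          functional_gt0 f & adjoint S f =1 (fun x => spectral_radius S * f x)]].
  by case: irr => [|[]]; [left | right].
have [Q [e [f [F [pQ [e0 en0 Se fe] [QE fS] [f0 fs F0 fF] kill]]]]] :=
  irreducible_pole_rank1 hS hST pole irr.
apply: (conclude e f) => //.
exact: (@residue_dominated_eq0 _ _ S T Q e f F).
Qed.
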